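(* Let $q,m,r,t,n$ be positive integers with $2\le q<r$, $m\ge 2$, $r\ge 3$ and $n\ge t=r+(m-1)q$. Let $SH(m,q,r)$ be the sunflower hypergraph on $[t]$ with kernel $X=\{1,\ldots,r-q\}$ and petals $Y_l=\{r+(l-2)q+1,\ldots,r+(l-1)q\}$, $1\le l\le m$. Let $p_1,p_2,\ldots,p_c$ be all the maximum points of $$[g_{r-q}(s)]^{\frac{r-1}{r-q}}\cdot\left[m-1+[g_q(n-s-(m-1)q)]^{\frac{r-1}{r-q}}\right]$$ where $s$ ranges over the integers with $r-q\le s\le n-mq$. For each $k\in[c]$, let $H_k=SH(m,q,r)\circ(n_1,\ldots,n_t)$ where $\sum_{i\in X}n_i=p_k$, $\sum_{j\in Y_m}n_j=n-(m-1)q-p_k$, $|n_i-n_j|\le 1$ for any two distinct vertices $i,j\in X$ or $i,j\in Y_m$, and $n_j=1$ for each $j\in\bigcup_{l=1}^{m-1}Y_l$. Then, in $\mathcal{B}_n(SH(m,q,r))$: (1) $SH(m,q,r)\circ(n_1,\ldots,n_t)$ attains the minimum spectral radius if and only if each of $n_r,n_{r+q},\ldots,n_{r+(m-1)q}$ is equal to $\left\lfloor\frac{n-t}{m}\right\rfloor+1$ or $\left\lceil\frac{n-t}{m}\right\rceil+1$, and $n_i=1$ for each $i\in[t]\setminus\{r,r+q,\ldots,r+(m-1)q\}$. (2) $H=SH(m,q,r)\circ(n_1,\ldots,n_t)$ attains the maximum spectral radius if and only if $H$ is isomorphic to one of $H_1,H_2,\ldots,H_c$.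
   Context: An $r$-uniform hypergraph $H$ has a finite vertex set $V(H)$ and an edge set $E(H)$ of $r$-element subsets of $V(H)$; its order is $|V(H)|$. If $V(H)=\{v_1,\ldots,v_n\}$, its adjacency tensor $\mathcal{A}(H)=(a_{i_1\cdots i_r})$ of order $r$ and dimension $n$ has $a_{i_1\cdots i_r}=\frac{1}{(r-1)!}$ if $\{v_{i_1},\ldots,v_{i_r}\}\in E(H)$ and $0$ otherwise. A number $\lambda\in\mathbb{C}$ is an eigenvalue of $\mathcal{A}(H)$ if there is $\mathbf{x}\in\mathbb{C}^n\setminus\{0\}$ with $\sum_{i_2,\ldots,i_r\in[n]}a_{ii_2\cdots i_r}x_{i_2}\cdots x_{i_r}=\lambda x_i^{r-1}$ for all $i\in[n]$. The spectral radius $\rho(H)$ is the maximum of $|\lambda|$ over all eigenvalues $\lambda$ of $\mathcal{A}(H)$. For an $r$-uniform hypergraph $G$ with $V(G)=[t]=\{1,\ldots,t\}$ and a vector $(n_1,\ldots,n_t)$ of positive integers, the blow-up $G\circ(n_1,\ldots,n_t)$ is the $r$-uniform hypergraph whose vertex set is a disjoint union $V_1\cup\cdots\cup V_t$ with $|V_j|=n_j$, and whose edges are exactly the sets $\{u_1,\ldots,u_r\}$ with $u_1\in V_{j_1},\ldots,u_r\in V_{j_r}$ for some $\{j_1,\ldots,j_r\}\in E(G)$. $\mathcal{B}_n(G)$ is the set of all $G\circ(n_1,\ldots,n_t)$ with all $n_i$ positive integers and $\sum_{i=1}^t n_i=n$. For $m>0$ and $0<q<r$, the sunflower hypergraph $SH(m,q,r)$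 has vertex set $X\cup Y_1\cup\cdots\cup Y_m$ (disjoint union), with $|X|=r-q$ (kernel) and $|Y_l|=q$ (petals), and edges $X\cup Y_l$ for $1\le l\le m$. For a positive integer $p$ and an integer $s\ge p$, define $g_p(s)=a^{p-l}(a+1)^{l}$, where $s=ap+l$, $a=\lfloor s/p\rfloor$ and $0\le l\le p-1$ (so $g_1(s)=s$).
   Formalization: Part (1) is proved up to isomorphism: the blow-up attains the minimum iff it is isomorphic to one whose vector has the stated form; the literal ''only if'' fails since the excess of a petal may sit on any of its vertices (e.g. q=2, r=3, m=2, n=6, n_2=2). *)

(* Defs.v *)
From HB Require Import structures.
From mathcomp Require Import all_boot all_order all_algebra.
From mathcomp Require Import complex.
From mathcomp Require Import reals exp.

Set Implicit Arguments.
Unset Strict Implicit.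
Unset Printing Implicit Defensive.

Import Order.TTheory GRing.Theory Num.Theory.

Local Open Scope ring_scope.

Record hypergraph (r : nat) := Hypergraph {
  vertices : finType;
  edges : {set {set vertices}};
  edges_uniform : forall e, e \in edges -> #|e| = r }.

Arguments Hypergraph {r vertices edges}.
Arguments edges {r}.

Definition isomorphic (r : nat) (H K : hypergraph r) : Prop :=
  exists2 f : vertices H -> vertices K, bijective f &
    forall e : {set vertices H}, (e \in edges H) = (f @: e \in edges K).

(* The order of the tensor is k.+1, and its dimension is #|V|: coordinates are
   indexed by the elements of V. *)
Definition tensor_eigenvalue (R : realType) (k : nat) (V : finType)
    (A : k.+1.-tuple V -> R[i]) (lambda : R[i]) : Prop :=
  exists2 x : V -> R[i], exists i, x i != 0 &
    forall i, \sum_(s : k.-tuple V) A [tuple of i :: s] * \prod_(j <- s) x j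
              = lambda * x i ^+ k.

(* r.-1.+1 is r as soon as 0 < r. *)
Definition adjacency_tensor (R : realType) (r : nat) (H : hypergraph r)
    (s : r.-1.+1.-tuple (vertices H)) : R[i] :=
  if [set v in s] \in edges H then ((r.-1)`!%:R)^-1 else 0.

Definition is_spectral_radius (R : realType) (r : nat) (H : hypergraph r)
    (rho : R) : Prop :=
  (exists2 lambda, tensor_eigenvalue (@adjacency_tensor R r H) lambda &
     `|lambda| = rho%:C%C) /\
  (forall lambda, tensor_eigenvalue (@adjacency_tensor R r H) lambda ->
     `|lambda| <= rho%:C%C).

Definition attains_min_spectral_radius (R : realType) (r : nat)
    (B : hypergraph r -> Prop) (H : hypergraph r) : Prop :=
  B H /\ exists2 rho : R, is_spectral_radius H rho &
    forall K, B K -> exists2 rho' : R, is_spectral_radius K rho' & rho <= rho'.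

Definition attains_max_spectral_radius (R : realType) (r : nat)
    (B : hypergraph r -> Prop) (H : hypergraph r) : Prop :=
  B H /\ exists2 rho : R, is_spectral_radius H rho &
    forall K, B K -> exists2 rho' : R, is_spectral_radius K rho' & rho' <= rho.

Local Open Scope nat_scope.

(* The class V_j is the fibre of tag over j. *)
Definition blowup_edges (r : nat) (G : hypergraph r) (w : vertices G -> nat)
    : {set {set {j : vertices G & 'I_(w j)}}} :=
  [set [set u in us] | us : r.-tuple {j : vertices G & 'I_(w j)}
                       & [set tag u | u in us] \in edges G].

Lemma blowup_edges_uniform (r : nat) (G : hypergraph r)
    (w : vertices G -> nat) e :
  e \in blowup_edges w -> #|e| = r.
Proof.
case/imsetP=> us; rewrite inE => /edges_uniform card_tag ->.
rewrite cardsE; apply/eqP; rewrite eqn_leq.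
rewrite (leq_trans (card_size _)) ?size_tuple //=.
by rewrite -[leqLHS]card_tag leq_imset_card.
Qed.

Definition blowup (r : nat) (G : hypergraph r) (w : vertices G -> nat)
    : hypergraph r :=
  Hypergraph (@blowup_edges_uniform r G w).

Arguments blowup {r} G w.

Definition blowup_vector (r : nat) (G : hypergraph r) (n : nat)
    (w : vertices G -> nat) : Prop :=
  (forall j, 0 < w j) /\ \sum_j w j = n.

Arguments blowup_vector {r} G n w.

Definition blowups (r : nat) (G : hypergraph r) (n : nat)
    (H : hypergraph r) : Prop :=
  exists2 w : vertices G -> nat, blowup_vector G n w & H = blowup G w.

(* In the sunflower, i : 'I_t stands for the vertex i + 1 of [t], and petals are
   numbered from 0: petal t q r l is Y_(l + 1). *)
Definition kernel (t q r : nat) : {set 'I_t} := [set i : 'I_t | i < r - q].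

Definition petal (t q r l : nat) : {set 'I_t} :=
  [set i : 'I_t | r - q + l * q <= i < r + l * q].

Definition sunflower_edges (t m q r : nat) : {set {set 'I_t}} :=
  [set kernel t q r :|: petal t q r l | l : 'I_m].

Lemma card_ord_interval (t a b : nat) :
  b <= t -> #|[set i : 'I_t | a <= i < b]| = b - a.
Proof.
move=> le_bt; rewrite -sum1dep_card.
have <- : \sum_(0 <= i < t | a <= i < b) 1 = \sum_(i < t | a <= i < b) 1.
  by rewrite big_mkord.
rewrite -[RHS]muln1 -sum_nat_const_nat [RHS](big_nat_widen _ _ t) //.
by rewrite [RHS](big_nat_widenl a 0) //; apply: eq_bigl => i; rewrite andbC.
Qed.

Lemma sunflower_edges_uniform (t m q r : nat) (lt_qr : q < r)
    (t_def : t = r + (m - 1) * q) e :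
  e \in sunflower_edges t m q r -> #|e| = r.
Proof.
case/imsetP=> l _ ->; have le_qr := ltnW lt_qr.
have le_l : r + l * q <= t.
  by rewrite t_def leq_add2l leq_mul2r subn1 -ltnS (ltn_predK (ltn_ord l))
             ltn_ord orbT.
have -> : kernel t q r = [set i : 'I_t | 0 <= i < r - q] by apply/setP=> i.
rewrite cardsU (_ : _ :&: _ = set0) ?cards0 ?subn0.
  rewrite !card_ord_interval //; last first.
    by rewrite (leq_trans _ le_l) // (leq_trans (leq_subr _ _)) ?leq_addr.
  by rewrite subn0 subnDr subKn ?subnK.
apply/setP=> i; rewrite !inE /=; case: ltnP => //= le_i.
by rewrite leqNgt (leq_trans le_i) ?leq_addr.
Qed.

Definition sunflower (t m q r : nat) (lt_qr : q < r)
    (t_def : t = r + (m - 1) * q) : hypergraph r :=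
  Hypergraph (sunflower_edges_uniform lt_qr t_def).

Definition g (p s : nat) : nat :=
  (s %/ p) ^ (p - s %% p) * (s %/ p).+1 ^ (s %% p).

Definition sunflower_objective (R : realType) (m q r n s : nat) : R :=
  let alpha : R := ((r - 1)%:R / (r - q)%:R)%R in
  (((g (r - q) s)%:R `^ alpha) *
   ((m - 1)%:R + (g q (n - s - (m - 1) * q))%:R `^ alpha))%R.

Definition is_maximum_point (R : realType) (m q r n p : nat) : Prop :=
  r - q <= p <= n - m * q /\
  forall s, r - q <= s <= n - m * q ->
    (sunflower_objective R m q r n s <= sunflower_objective R m q r n p)%R.

Definition ceil_div (a b : nat) : nat := (a + (b - 1)) %/ b.

(* The vertices r, r + q, ..., r + (m - 1)q of [t] are the last vertices of the
   petals. *)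
Definition minimizing_vector (t m q r n : nat) (w : 'I_t -> nat) : Prop :=
  forall i : 'I_t,
    if [exists l : 'I_m, i.+1 == r + l * q]
    then w i = (n - t) %/ m + 1 \/ w i = ceil_div (n - t) m + 1
    else w i = 1.

Definition maximizing_vector (t m q r n p : nat) (w : 'I_t -> nat) : Prop :=
  [/\ \sum_(i in kernel t q r) w i = p,
      \sum_(j in petal t q r (m - 1)) w j = n - (m - 1) * q - p,
      forall i j,
        (i \in kernel t q r) && (j \in kernel t q r) ||
        (i \in petal t q r (m - 1)) && (j \in petal t q r (m - 1)) ->
        `|w i - w j| <= 1 &
      forall l, l < m - 1 -> forall j, j \in petal t q r l -> w j = 1].

(* Main.v *)
Require Import Defs.
From mathcomp Require Import all_boot all_order all_algebra.
From mathcomp Require Import perm complex.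
From mathcomp Require Import reals sequences exp.
From mathcomp Require Import ring lra zify.

(** Write [k = r - q] and [al = (r - 1) / k], and let [W_K] and [W_l] be the
    products of the class sizes over the kernel and over the petal [Y_l]. The
    spectral radius [rho] of the blow-up satisfies
    [rho ^ r = (W_K ^ al * \sum_l W_l ^ al) ^ k]: a positive eigenvector can be
    written down, and for an arbitrary eigenpair the moduli of the coordinates
    are constant on the classes and satisfy the inequalities that correspond to
    the equations of the positive eigenvector. It remains to optimize
    [W_K ^ al * \sum_l W_l ^ al].

    Minimum: a product of positive integers with given sum is smallest when all
    factors but one are [1]; as [al > 1], moving the excess of the kernel into
    a petal decreases the value, and strict convexity of [x ^ al] balances the
    petals.

    Maximum: moving the excess of one petal onto another one increases the
    value, since [\prod (u_i + v_i - 1) >= \prod u_i + \prod v_i - 1] and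
    [x ^ al] is strictly convex, so at most one petal is blown up; products
    with given sum are largest when balanced, by strict concavity of [ln]. *)

Set Implicit Arguments.
Unset Strict Implicit.
Unset Printing Implicit Defensive.

Import Order.TTheory GRing.Theory Num.Theory.

Local Open Scope ring_scope.

(** * Strictly convex sequences and products with given sum *)

Lemma ln_lt_subr1 (R : realType) (x : R) : 0 < x -> x != 1 -> ln x < x - 1.
Proof.
move=> x_gt0 x_neq1; have : ln x != 0 by rewrite ln_eq0.
by move/expR_gt1Dx; rewrite lnK ?posrE // -ltrBrDl.
Qed.

Lemma ln_le_subr1 (R : realType) (x : R) : 0 < x -> ln x <= x - 1.
Proof.
move=> x_gt0; have [-> | x1] := eqVneq x 1; first by rewrite ln1 subrr.
by rewrite ltW // ln_lt_subr1.
Qed.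

(** With [M] the left side, only [M > 0] needs work. There [ln (M / u) < M / u - 1], which equals
    [(al - 1) * (1 - 1 / u)], and this is at most [(al - 1) * ln u]; hence [ln M < al * ln u]. *)
Lemma bernoulli_powR (R : realType) (al u : R) :
  1 < al -> 0 < u -> u != 1 -> 1 + al * (u - 1) < u `^ al.
Proof.
move=> al_gt1 u_gt0 u_neq1; have al_gt0 : 0 < al by lra.
have [M_le0 | M_gt0] := lerP (1 + al * (u - 1)) 0.
  exact: le_lt_trans M_le0 (powR_gt0 _ u_gt0).
set M := 1 + _ in M_gt0 *.
rewrite -ltr_ln ?posrE ?powR_gt0 // ln_powR.
have Mu_neq1 : M / u != 1.
  apply: contra_neq u_neq1 => /(congr1 ( *%R^~ u)); rewrite mulfVK ?gt_eqF // mul1r => Mu.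
  have : (al - 1) * (u - 1) = 0 by rewrite /M in Mu; lra.
  by move/eqP; rewrite mulf_eq0 => /orP[] /eqP; lra.
have := ln_lt_subr1 (divr_gt0 M_gt0 u_gt0) Mu_neq1; rewrite ln_div ?posrE // => h1.
have := @ln_le_subr1 _ u^-1; rewrite invr_gt0 lnV ?posrE // => /(_ u_gt0) h2.
have h3 : (al - 1) * - ln u <= (al - 1) * (u^-1 - 1) by rewrite ler_wpM2l //; lra.
have h4 : M / u - 1 + (al - 1) * (u^-1 - 1) = 0.
  by rewrite /M; field; rewrite gt_eqF.
lra.
Qed.

(** Bernoulli's inequality at [x / c], scaled by the power of [c]: the graph lies strictly above its
    tangent at [c]. *)
Lemma powR_tangent (R : realType) (al c x : R) :
  1 < al -> 0 < c -> 0 < x -> x != c ->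
  c `^ al + al * (c `^ al / c) * (x - c) < x `^ al.
Proof.
move=> al_gt1 c_gt0 x_gt0 xc.
have u_neq1 : x / c != 1.
  by apply: contra_neq xc => /(congr1 ( *%R^~ c)); rewrite mulfVK ?gt_eqF // mul1r.
have := bernoulli_powR al_gt1 (divr_gt0 x_gt0 c_gt0) u_neq1.
rewrite -(ltr_pM2l (powR_gt0 al c_gt0)) -powRM ?(ltW c_gt0) //;
  last by rewrite divr_ge0 ?(ltW x_gt0) ?(ltW c_gt0).
rewrite [X in _ < X `^ _]mulrC mulfVK ?gt_eqF //; congr (_ < _).
by field; rewrite gt_eqF.
Qed.

(** Index 0 is left out because the logarithm is concave only on positive integers. *)
Definition strictly_convex_seq (R : realType) (f : nat -> R) :=
  forall n, (0 < n)%N -> f n.+1 - f n < f n.+2 - f n.+1.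

(** The values at [n] and [n.+2] both lie strictly above the tangent at [n.+1]; the two slopes
    cancel in the sum. *)
Lemma powR_strictly_convex (R : realType) (al : R) :
  1 < al -> strictly_convex_seq (fun n => n%:R `^ al).
Proof.
move=> al_gt1 n n_gt0.
have n_gt0R : 0 < n%:R :> R by rewrite ltr0n.
have := @powR_tangent _ al n.+1%:R n%:R al_gt1.
have := @powR_tangent _ al n.+1%:R n.+2%:R al_gt1.
rewrite !ltr0n n_gt0 !eqr_nat => /(_ isT isT) h2 /(_ isT isT) h1.
have {}h1 := h1 _; have {}h2 := h2 _.
move: (h1 ltac:(lia)) (h2 ltac:(lia)).
have -> : n%:R - n.+1%:R = -1 :> R by rewrite -natr1; ring.
have -> : n.+2%:R - n.+1%:R = 1 :> R by rewrite -natr1; ring.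
set c := al * _; move=> {}h1 {}h2; lra.
Qed.

Lemma ln_strictly_concave (R : realType) :
  strictly_convex_seq (fun n => - ln n%:R : R).
Proof.
move=> n n_gt0; have n_gt0R : 0 < n%:R :> R by rewrite ltr0n.
suff : ln (n%:R * n.+2%:R : R) < ln (n.+1%:R * n.+1%:R).
  rewrite !lnM ?posrE ?ltr0n // => h; lra.
by rewrite ltr_ln ?posrE ?mulr_gt0 ?ltr0n // -!natrM ltr_nat; lia.
Qed.

Section ConvexSeq.

Variables (R : realType) (f : nat -> R).
Hypothesis f_convex : strictly_convex_seq f.

Lemma convex_seq_incr x y :
  (0 < x)%N -> (x < y)%N -> f x.+1 - f x < f y.+1 - f y.
Proof.
move=> x_gt0; elim: y => // y IHy; rewrite ltnS leq_eqVlt => /predU1P[<- | xy].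
  exact: f_convex.
apply: (lt_trans (IHy xy)); apply: f_convex; lia.
Qed.

Lemma convex_seq_shift x y j :
  (0 < x)%N -> (x < y)%N -> (0 < j)%N -> f (x + j) - f x < f (y + j) - f y.
Proof.
move=> x_gt0 xy; case: j => // j _; elim: j => [|j IHj].
  by rewrite !addn1 convex_seq_incr.
have := @convex_seq_incr (x + j.+1) (y + j.+1); rewrite addn_gt0 x_gt0 ltn_add2r.
move=> /(_ isT xy); rewrite !addnS in IHj * => h; lra.
Qed.

(** Differences increase, so the sequence leaves the chord through [a] and [a.+1] upwards on both
    sides. A chord is used rather than a tangent because equality at two consecutive integers is
    what characterizes balanced families. *)
Lemma convex_seq_supporting_line a x :
  (0 < a)%N -> (0 < x)%N ->
  f a + (x%:R - a%:R) * (f a.+1 - f a) <= f x ?= iff (x == a) || (x == a.+1).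
Proof.
move=> a_gt0 x_gt0; set d := f a.+1 - f a.
have right j : f a.+1 + j%:R * d <= f (a.+1 + j)%N ?= iff (j == 0)%N.
  elim: j => [|j [IHj _]]; first by rewrite mul0r addr0 addn0; apply/leif_refl.
  rewrite (_ : (j.+1 == 0)%N = false) //; apply/leifP.
  have := @convex_seq_incr a (a.+1 + j) a_gt0; rewrite -/d addnS => /(_ _)/= h.
  have {}h := h ltac:(lia); rewrite -natr1; lra.
have left j : (j < a)%N -> f a - j%:R * d <= f (a - j)%N ?= iff (j == 0)%N.
  elim: j => [|j IHj] ja; first by rewrite mul0r subr0 subn0; apply/leif_refl.
  have [{}IHj _] := IHj ltac:(lia).
  rewrite (_ : (j.+1 == 0)%N = false) //; apply/leifP.
  have := @convex_seq_incr (a - j.+1) a; rewrite subn_gt0 ja -/d.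
  rewrite (_ : (a - j.+1).+1 = a - j)%N; last by lia.
  move=> /(_ isT ltac:(lia)) h; rewrite -natr1; lra.
have [xa | ax] := leqP x a.
  have := left (a - x)%N ltac:(lia); rewrite subKn // natrB // => h.
  rewrite (_ : (_ || _) = (a - x == 0)%N); last by lia.
  by move: h; congr (_ <= _ ?= iff _); ring.
have := right (x - a.+1)%N; rewrite subnKC // natrB // => h.
rewrite (_ : (_ || _) = (x - a.+1 == 0)%N); last by lia.
by move: h; congr (_ <= _ ?= iff _); rewrite /d -natr1; ring.
Qed.

(** The chord inequality summed over [P]. The left side depends on [e] only through its sum, so this
    bounds all families with a given sum at once. *)
Lemma convex_seq_sum (I : finType) (P : pred I) (e : I -> nat) a :
  (0 < a)%N -> (forall i, P i -> (0 < e i)%N) ->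
  #|P|%:R * f a + ((\sum_(i | P i) e i)%:R - #|P|%:R * a%:R) * (f a.+1 - f a)
    <= \sum_(i | P i) f (e i)
    ?= iff [forall (i | P i), (e i == a) || (e i == a.+1)].
Proof.
move=> a_gt0 e_gt0.
rewrite (_ : _ + _ = \sum_(i | P i) (f a + ((e i)%:R - a%:R) * (f a.+1 - f a))).
  by apply: leif_sum => i Pi; apply: convex_seq_supporting_line; rewrite ?e_gt0.
rewrite big_split /= -big_distrl /= sumrB natr_sum !sumr_const.
by rewrite !mulr_natl.
Qed.

End ConvexSeq.

(* [R] only serves to compare the logarithms of the two sides. *)
Lemma prod_leq_g (R : realType) (I : finType) (P : pred I) (e : I -> nat) :
  (0 < #|P|)%N -> (forall i, P i -> (0 < e i)%N) ->
  let s := \sum_(i | P i) e i in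
  (\prod_(i | P i) e i <= g #|P| s
     ?= iff [forall (i | P i), (e i == s %/ #|P|) || (e i == (s %/ #|P|).+1)])%N.
Proof.
move=> P_gt0 e_gt0 s; set a := (s %/ #|P|)%N.
have s_ge : (#|P| <= s)%N.
  by rewrite -[leqLHS]muln1 -sum_nat_const; apply: leq_sum => i /e_gt0.
have a_gt0 : (0 < a)%N by rewrite divn_gt0.
have g_gt0 : (0 < g #|P| s)%N by rewrite muln_gt0 !expn_gt0 a_gt0.
have prod_gt0 : (0 < \prod_(i | P i) e i)%N by apply: prodn_cond_gt0.
have l_lt : (s %% #|P| < #|P|)%N by rewrite ltn_mod.
have [] := convex_seq_sum (@ln_strictly_concave R) a_gt0 e_gt0.
rewrite -/s sumrN.
have -> : \sum_(i | P i) ln (e i)%:R = ln (\prod_(i | P i) e i)%:R :> R.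
  suff [] : \sum_(i | P i) ln (e i)%:R = ln (\prod_(i | P i) e i)%:R :> R /\
      (0 < \prod_(i | P i) e i)%N by [].
  elim/big_rec2: _ => [|i x y Pi [-> x_gt0]]; first by rewrite ln1.
  by rewrite muln_gt0 x_gt0 e_gt0 // natrM lnM // posrE ltr0n ?e_gt0.
(* As [a] is the quotient of [s], the coefficient of the slope is the remainder, which is the
   exponent of [a.+1] in [g]. *)
have -> : #|P|%:R * - ln a%:R + (s%:R - #|P|%:R * a%:R) * (- ln a.+1%:R - - ln a%:R) =
    - ln (g #|P| s)%:R :> R.
  rewrite /g -/a natrM !natrX lnM ?posrE ?exprn_gt0 ?ltr0n // !lnXn ?ltr0n //.
  have -> : s%:R = a%:R * #|P|%:R + (s %% #|P|)%N%:R :> R.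
    by rewrite -natrM -natrD -divn_eq.
  rewrite -!(mulr_natl (ln _)) natrB ?(ltnW l_lt) //.
  ring.
rewrite lerN2 ler_ln ?posrE ?ltr0n // ler_nat eqr_opp => le_g eq_g; split=> //.
by rewrite -eq_g eq_sym (inj_in_eq (@ln_inj R)) ?posrE ?ltr0n // eqr_nat.
Qed.

(** By induction from [x * y >= x + y - 1] for positive [x] and [y]. It bounds the weight of a class
    below by its excess over all-one sizes. *)
Lemma prod_gt_sum (I : finType) (P : pred I) (w : I -> nat) :
  (forall i, P i -> (0 < w i)%N) ->
  (\sum_(i | P i) (w i).-1 < \prod_(i | P i) w i)%N.
Proof.
by move=> w_gt0; elim/big_rec2: _ => // i x y /w_gt0; nia.
Qed.

(** Two factors that are at least 2 produce a cross term that makes the inequality of [prod_gt_sum]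
    slack by more than one. *)
Lemma prod_eq_sum (I : finType) (P : pred I) (w : I -> nat) :
  (forall i, P i -> (0 < w i)%N) ->
  (\prod_(i | P i) w i = (\sum_(i | P i) (w i).-1).+1)%N ->
  forall i j, P i -> P j -> i != j -> w i = 1%N \/ w j = 1%N.
Proof.
move=> w_gt0 + i j Pi Pj ij.
rewrite (bigD1 i) // (bigD1 j) /=; last by rewrite Pj eq_sym.
rewrite [in RHS](bigD1 i) // [in RHS](bigD1 j) /=; last by rewrite Pj eq_sym.
have := @prod_gt_sum _ (fun l => P l && (l != i) && (l != j)) w.
move=> /(_ (fun l Pl => w_gt0 l (proj1 (andP (proj1 (andP Pl)))))).
move: (w_gt0 i Pi) (w_gt0 j Pj) (\prod_(l | _) _) (\sum_(l | _) _) => wi wj X Y YX.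
case: (w i) wi => [|[|a]] // _; first by left.
case: (w j) wj => [|[|b]] // _; first by right.
have : (a.+2 * b.+2 * Y.+1 <= a.+2 * b.+2 * X)%N by rewrite leq_mul2l YX orbT.
nia.
Qed.

(** The induction step rests on [(u + v - 1)(y + z - 1) - (u y + v z - 1) = (u - 1)(z - 1) + (v -
    1)(y - 1)], which is nonnegative for positive numbers; positivity of the partial products is
    carried along. *)
Lemma prod_merge (I : finType) (P : pred I) (u v : I -> nat) :
  (forall i, P i -> (0 < u i)%N) -> (forall i, P i -> (0 < v i)%N) ->
  (\prod_(i | P i) u i + \prod_(i | P i) v i
     <= (\prod_(i | P i) (u i + (v i).-1)).+1)%N.
Proof.
move=> u_gt0 v_gt0.
suff [] : [/\ (0 < \prod_(i | P i) u i)%N, (0 < \prod_(i | P i) v i)%N &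
  (\prod_(i | P i) u i + \prod_(i | P i) v i
     <= (\prod_(i | P i) (u i + (v i).-1)).+1)%N] by [].
elim/big_rec3: _ => // i x y z Pi [z_gt0 y_gt0 le_x].
move: (u_gt0 i Pi) (v_gt0 i Pi) => ui vi; split; [lia | lia |].
case: (u i) ui => // a _; case: (v i) vi => // b _ /=.
case: z z_gt0 le_x => // z _; case: y y_gt0 => // y _ le_x.
have : ((a.+1 + b) * (z + y).+1 <= (a.+1 + b) * x)%N.
  by rewrite leq_mul2l; apply/orP; right; lia.
nia.
Qed.

(** Every index gets the quotient, and as many indices as the remainder says get one more. *)
Lemma exists_balanced (I : finType) (P : pred I) (s : nat) :
  (0 < #|P|)%N ->
  exists2 v : I -> nat,
    [forall (i | P i), (v i == s %/ #|P|) || (v i == (s %/ #|P|).+1)]%N &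
    (\sum_(i | P i) v i = s)%N.
Proof.
move=> P_gt0.
have /card_geqP[l [l_uniq size_l l_sub]] : (s %% #|P| <= #|P|)%N by rewrite ltnW ?ltn_mod.
exists (fun i => s %/ #|P| + (i \in l))%N.
  by apply/forall_inP => i _; case: (i \in l); rewrite ?addn1 ?addn0 eqxx ?orbT.
rewrite big_split /= sum_nat_const mulnC [RHS](divn_eq s #|P|); congr (_ + _)%N.
rewrite -size_l -(card_uniqP l_uniq) -sum1_card big_mkcond [RHS]big_mkcond /=.
apply: eq_bigr => i _; case: ifPn => [_|]; first by case: (i \in l).
by case: (boolP (i \in l)) => // /l_sub; rewrite unfold_in => ->.
Qed.

(** If values differ by at most one, the quotient is their minimum [v j]: the sum is at least
    [#|P| * v j], and less than [#|P| * (v j).+1] since the minimum is attained. *)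
Lemma balancedP (I : finType) (P : pred I) (v : I -> nat) :
  (0 < #|P|)%N ->
  let a := ((\sum_(i | P i) v i) %/ #|P|)%N in
  (forall i j, P i -> P j -> (v i <= (v j).+1)%N) <->
  [forall (i | P i), (v i == a) || (v i == a.+1)].
Proof.
move=> P_gt0 a; split=> [bal | /forall_inP bal i j Pi Pj]; last first.
  by have := bal i Pi; have := bal j Pj; lia.
have [i0 Pi0] : exists i, P i by case/card_gt0P: P_gt0 => i; exists i.
case: (arg_minnP v Pi0) => j Pj min_j.
suff aE : a = v j.
  by apply/forall_inP => i Pi; rewrite aE; have := bal i j Pi Pj; have := min_j i Pi; lia.
have sum_const c : (\sum_(i | P i) c = #|P| * c)%N by rewrite sum_nat_const.
rewrite /a; apply/eqP; rewrite eqn_leq -ltnS ltn_divLR // leq_divRL //.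
apply/andP; split; last by rewrite mulnC -sum_const; apply: leq_sum.
rewrite mulnC -sum_const (bigD1 j) //= [X in (_ < X)%N](bigD1 j) //= addSn ltnS.
by rewrite leq_add2l; apply: leq_sum => i /andP[Pi _]; apply: bal.
Qed.

(** * Eigenvalues of blow-ups *)

(** The left side of the eigenvalue equation at [i], after the [(r - 1)!] orderings of the rest of
    each edge have cancelled the tensor entry. *)
Definition edge_sum (C : comPzRingType) (T : finType) (E : {set {set T}})
    (x : T -> C) (i : T) : C :=
  \sum_(e in E | i \in e) \prod_(j in e :\ i) x j.

(** By cardinality, the tuples that complete [i] to [e] are exactly the orderings of [e :\ i]: a
    repetition would make the set too small. *)
Lemma sum_tuple_set (C : comPzRingType) (T : finType) (x : T -> C) (k : nat)
    (e : {set T}) (i : T) :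
  #|e| = k.+1 ->
  \sum_(s : k.-tuple T | [set v in i :: s] == e) \prod_(j <- s) x j =
  if i \in e then (\prod_(j in e :\ i) x j) *+ k`! else 0.
Proof.
move=> card_e; case: ifPn => [ie | nie]; last first.
  rewrite big_pred0 // => s; apply: contraNF nie => /eqP <-.
  by rewrite !inE eqxx.
have card_ei : #|e :\ i| = k by move: card_e; rewrite (cardsD1 i) ie add1n => -[].
have condE (s : k.-tuple T) :
    ([set v in i :: s] == e) = all [in e :\ i] s && uniq s.
  apply/eqP/andP => [se | [/allP s_e us]].
    have us : uniq (i :: s).
      by apply/card_uniqP; rewrite -[LHS]cardsE se card_e /= size_tuple.
    split; last by case/andP: us.
    apply/allP => j js; rewrite !inE -se inE in_cons js orbT andbT.
    by apply: contraTneq js => ->; case/andP: us.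
  apply/eqP; rewrite eqEcard card_e; apply/andP; split.
    apply/subsetP => j; rewrite !inE => /predU1P [-> // | /s_e].
    by rewrite !inE => /andP[].
  rewrite cardsE (card_uniqP _) /= ?size_tuple ?us ?andbT //.
  by apply/negP => /s_e; rewrite !inE eqxx.
rewrite (eq_bigl _ _ condE).
rewrite (eq_bigr (fun _ : k.-tuple T => \prod_(j in e :\ i) x j)); last first.
  move=> s; case/andP => /allP s_e us; rewrite big_uniq //=.
  apply: eq_bigl => j.
  have : s =i e :\ i.
    apply/subset_cardP; last by apply/subsetP => u; apply: s_e.
    by rewrite (card_uniqP us) size_tuple card_ei.
  by move=> ->.
rewrite sumr_const -[in LHS]cardsE card_uniq_tuples card_ei ffactnn //.
Qed.

(** Tuples are grouped by the edge they form with [i]. The coefficient [c] is free, so that the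
    lemma serves both the tensor entry and, with [c = 1], the comparison of a blow-up with its
    base. *)
Lemma sum_tuple_edges (C : comPzRingType) (T : finType) (k : nat)
    (E : {set {set T}}) (c : C) (x : T -> C) (i : T) :
  {in E, forall e : {set T}, #|e| = k.+1} ->
  \sum_(s : k.-tuple T)
     (if [set v in i :: s] \in E then c else 0) * \prod_(j <- s) x j =
  c * edge_sum E x i *+ k`!.
Proof.
move=> unifE; rewrite (bigID (fun s : k.-tuple T => [set v in i :: s] \in E)) /=.
rewrite addrC big1 ?add0r; last by move=> s /negPf ->; rewrite mul0r.
rewrite (eq_bigr (fun s : k.-tuple T => c * \prod_(j <- s) x j)); last first.
  by move=> s ->.
rewrite -big_distrr /= -mulrnAr; congr (_ * _).
rewrite (partition_big (fun s : k.-tuple T => [set v in i :: s]) (mem E)) //=.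
rewrite /edge_sum big_mkcondr -sumrMnl /=; apply: eq_bigr => e eE.
rewrite (eq_bigl (fun s : k.-tuple T => [set v in i :: s] == e)); last first.
  by move=> s; case: eqP => [-> | _]; rewrite ?andbF ?andbT.
by rewrite sum_tuple_set ?unifE //; case: ifP; rewrite ?mul0rn.
Qed.

Lemma adjacency_tensor_sum (R : realType) (r : nat) (H : hypergraph r)
    (x : vertices H -> R[i]) (i : vertices H) :
  (0 < r)%N ->
  \sum_(s : r.-1.-tuple (vertices H))
     adjacency_tensor R [tuple of i :: s] * \prod_(j <- s) x j =
  edge_sum (edges H) x i.
Proof.
move=> r_gt0; rewrite sum_tuple_edges; last first.
  by move=> e /edges_uniform ->; rewrite prednK.
rewrite -mulrnAl -mulr_natr mulVf ?mul1r //.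
by rewrite pnatr_eq0 -lt0n fact_gt0.
Qed.

Lemma eq_imset_mem (S T : finType) (h : S -> T) (A B : {pred S}) :
  A =i B -> h @: A = h @: B.
Proof.
by move=> eqAB; apply/setP=> j; apply/imsetP/imsetP => -[u uA ->];
  exists u; rewrite // eqAB in uA *.
Qed.

Lemma blowup_edgesE (r : nat) (G : hypergraph r) (w : vertices G -> nat)
    (e : {set {j : vertices G & 'I_(w j)}}) :
  (e \in blowup_edges w) = (#|e| == r) && ((@tag _ _) @: e \in edges G).
Proof.
apply/idP/andP => [e_b | [/eqP card_e tag_e]].
  rewrite (blowup_edges_uniform e_b) eqxx; split=> //.
  case/imsetP: e_b => us; rewrite inE => tag_us ->.
  suff <- : [set tag u | u in us] = (@tag _ _) @: [set u in us] by [].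
  by apply: eq_imset_mem => u; rewrite inE.
have size_e : size (enum e) == r by rewrite -cardE card_e.
apply/imsetP; exists (Tuple size_e); last by apply/setP => u; rewrite !inE mem_enum.
rewrite inE; suff -> : [set tag u | u in Tuple size_e] = (@tag _ _) @: e by [].
by apply: eq_imset_mem => u; rewrite mem_enum.
Qed.

(** Distributivity: a tuple over [t] is a choice of one point in the fibre of each entry of [t]. *)
Lemma sum_map_tuple (C : comPzRingType) (S T : finType) (h : S -> T)
    (x : S -> C) (k : nat) (t : k.-tuple T) :
  \sum_(s : k.-tuple S | map_tuple h s == t) \prod_(j <- s) x j =
  \prod_(j <- t) \sum_(u | h u == j) x u.
Proof.
rewrite big_tuple bigA_distr_big_dep /=.
rewrite (reindex (fun f : {ffun 'I_k -> S} => [tuple f j | j < k])) /=; last first.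
  exists (fun s : k.-tuple S => [ffun j => tnth s j]) => [f _ | s _].
    by apply/ffunP => j; rewrite ffunE tnth_mktuple.
  by apply: eq_from_tnth => j; rewrite tnth_mktuple ffunE.
apply: eq_big => [f | f _]; last first.
  by rewrite big_map big_enum.
apply/eqP/familyP => [ft j | f_fam].
  by rewrite unfold_in /= -ft tnth_map tnth_mktuple.
apply: eq_from_tnth => j; rewrite tnth_map tnth_mktuple.
by apply/eqP; apply: f_fam.
Qed.

(** Grouping vertex tuples by their tuples of classes shows that the equations see [x] only through
    its class sums. The passage to tuples multiplies by a factorial, which is cancelled in the
    field. *)
Lemma edge_sum_blowup (F : numFieldType) (r : nat) (G : hypergraph r)
    (w : vertices G -> nat) (x : {j : vertices G & 'I_(w j)} -> F) v :
  (0 < r)%N ->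
  edge_sum (blowup_edges w) x v =
  edge_sum (edges G) (fun j => \sum_(u | tag u == j) x u) (tag v).
Proof.
case: r => // k in G w x v * => _.
have k_neq0 : (k`!%:R : F) != 0 by rewrite pnatr_eq0 -lt0n fact_gt0.
apply: (mulIf k_neq0); rewrite !mulr_natr -[LHS]mul1r -[RHS]mul1r !mulrnAr.
rewrite -sum_tuple_edges; last by move=> e /blowup_edges_uniform.
rewrite -[RHS]sum_tuple_edges; last by move=> e /edges_uniform.
rewrite (partition_big (map_tuple (@tag _ _)) xpredT) //=.
apply: eq_bigr => t _; rewrite -sum_map_tuple big_distrr /=.
apply: eq_bigr => s /eqP <-; congr (_ * _).
suff -> : ([set u in v :: s] \in blowup_edges w) =
  ([set j in tag v :: map_tuple (@tag _ _) s] \in edges G) by [].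
have tagE : (@tag _ _) @: [set u in v :: s] =
            [set j in tag v :: map_tuple (@tag _ _) s].
  apply/setP => j; apply/imsetP/idP => [[u] | ].
    rewrite !inE => /predU1P[-> | us] ->; first by rewrite eqxx.
    by rewrite map_f ?orbT.
  rewrite !inE => /predU1P[-> | /mapP[u us ->]].
    by exists v; rewrite // !inE eqxx.
  by exists u; rewrite // !inE us orbT.
rewrite blowup_edgesE tagE andbC; case: (boolP (_ \in edges G)) => //= tag_e.
(* The set has at most [r] vertices because it comes from a tuple, and at least [r] because its
   classes form an edge. *)
rewrite eqn_leq; apply/andP; split.
  by rewrite cardsE (leq_trans (card_size _)) //= size_tuple.
by apply: leq_trans (leq_imset_card (@tag _ _) _); rewrite tagE (edges_uniform tag_e).
Qed.

Lemma isomorphic_sym (r : nat) (H K : hypergraph r) :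
  isomorphic H K -> isomorphic K H.
Proof.
case=> f [f' ff' f'f] edge_f; exists f'; first exact: (Bijective f'f ff').
by move=> e; rewrite edge_f -imset_comp (eq_imset _ f'f) imset_id.
Qed.

Lemma tensor_eigenvalue_isomorphic (R : realType) (r : nat) (H K : hypergraph r)
    (lambda : R[i]) :
  (0 < r)%N -> isomorphic H K ->
  tensor_eigenvalue (@adjacency_tensor R r H) lambda ->
  tensor_eigenvalue (@adjacency_tensor R r K) lambda.
Proof.
move=> r_gt0 /isomorphic_sym [f bij_f edge_f] [x [i xi] eigx].
exists (x \o f).
  by case: bij_f => g _ gK; exists (g i); rewrite /= gK.
move=> j /=; rewrite -eigx !adjacency_tensor_sum // /edge_sum.
have inj_f := bij_inj bij_f.
rewrite [RHS](reindex (fun e : {set vertices K} => f @: e)) /=; last first.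
  have [g fK gK] := bij_f; exists (fun e : {set vertices H} => g @: e) => e _.
    by rewrite -imset_comp (eq_imset _ fK) imset_id.
  by rewrite -imset_comp (eq_imset _ gK) imset_id.
apply: eq_big => [e | e _]; first by rewrite edge_f mem_imset.
rewrite -(big_imset x (in2W inj_f)) /=; apply: eq_bigl => u.
apply/idP/idP => [/imsetP[a /setD1P[aj ae] ->] | /setD1P[uj /imsetP[a ae ua]]].
  by rewrite in_setD1 inj_eq // aj imset_f.
apply/imsetP; exists a; rewrite // in_setD1 ae andbT.
by apply: contraNneq uj => aj; rewrite ua aj.
Qed.

Lemma is_spectral_radius_isomorphic (R : realType) (r : nat)
    (H K : hypergraph r) (rho : R) :
  (0 < r)%N -> isomorphic H K ->
  is_spectral_radius H rho -> is_spectral_radius K rho.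
Proof.
move=> r_gt0 isoHK [[lambda eigl norml] rho_max]; split.
  by exists lambda => //; apply: tensor_eigenvalue_isomorphic eigl.
move=> mu eigmu; apply: rho_max.
by apply: tensor_eigenvalue_isomorphic (isomorphic_sym isoHK) eigmu.
Qed.

Lemma is_spectral_radius_uniq (R : realType) (r : nat) (H : hypergraph r)
    (rho rho' : R) :
  is_spectral_radius H rho -> is_spectral_radius H rho' -> rho = rho'.
Proof.
move=> [[l el nl] ml] [[l' el' nl'] ml']; apply/eqP; rewrite eq_le.
by rewrite -!lecR -nl ml' // nl -nl' ml.
Qed.

(** Class [i] of the second blow-up has [w (s i)] vertices and is sent identically onto class [s i]
    of the first. *)
Lemma blowup_automorphism (r : nat) (G : hypergraph r) (w : vertices G -> nat)
    (s : vertices G -> vertices G) :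
  involutive s -> {in edges G, forall e : {set vertices G}, s @: e \in edges G} ->
  isomorphic (blowup G w) (blowup G (fun i => w (s i))).
Proof.
move=> sK s_edges; have s_inj := inv_inj sK; apply: isomorphic_sym.
pose f (u : {i : vertices G & 'I_(w (s i))}) : {i : vertices G & 'I_(w i)} :=
  Tagged (fun i => 'I_(w i)) (tagged u).
have f_inj : injective f.
  case=> i a [j b] /= eq_f; have ij : i = j by apply: s_inj; exact: (congr1 tag eq_f).
  subst j; suff -> : a = b by [].
  apply: val_inj.
  exact: (congr1 (fun u : {i : vertices G & 'I_(w i)} => nat_of_ord (tagged u)) eq_f).
exists f.
  apply: inj_card_bij f_inj _.
  have cardE (v : vertices G -> nat) : #|{: {i : vertices G & 'I_(v i)}}| = (\sum_i v i)%N.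
    transitivity (\sum_i \sum_(a : 'I_(v i) | true) 1)%N.
      by rewrite sig_big_dep -sum1_card; apply: eq_bigl.
    by apply: eq_bigr => i _; rewrite sum1_card card_ord.
  rewrite [leqLHS]cardE [leqRHS]cardE [leqLHS](reindex_inj s_inj) //.
have s_edgesE (e : {set vertices G}) : (s @: e \in edges G) = (e \in edges G).
  apply/idP/idP => [/s_edges | /s_edges //].
  by rewrite -imset_comp (eq_imset _ sK) imset_id.
move=> e; rewrite !blowup_edgesE card_imset //; congr (_ && _).
by rewrite -imset_comp -s_edgesE -imset_comp.
Qed.

(** * The spectral radius of a blow-up of a sunflower *)

Lemma exists_root (R : realType) (k : nat) (x : R) :
  (0 < k)%N -> 0 <= x -> exists2 y, 0 <= y & y ^+ k = x.
Proof.
move=> k_gt0 x_ge0; exists (x `^ k%:R^-1); first exact: powR_ge0.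
by rewrite -powR_mulrn ?powR_ge0 // -powRrM mulVf ?powRr1 // pnatr_eq0 -lt0n.
Qed.

Lemma card_blowup_class (T : finType) (w : T -> nat) (j : T) :
  #|[pred u : {i : T & 'I_(w i)} | tag u == j]| = w j.
Proof.
transitivity (\sum_(i | i == j) \sum_(a : 'I_(w i) | true) 1)%N.
  by rewrite sig_big_dep -sum1_card; apply: eq_bigl => u; rewrite /= andbT.
by rewrite big_pred1_eq sum1_card card_ord.
Qed.

Section Sunflower.

Variables (R : realType) (k q m r : nat) (G : hypergraph r).
(* [pet i] is the petal containing [i], or [None] if [i] is in the kernel. *)
Variable pet : vertices G -> option 'I_m.
Hypotheses (k_gt0 : (0 < k)%N) (q_gt0 : (0 < q)%N) (m_gt0 : (0 < m)%N).
Hypothesis r_def : r = (k + q)%N.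
Hypothesis card_pet : forall o : option 'I_m,
  #|[pred i | pet i == o]| = if o is Some _ then q else k.
Hypothesis edgesG : edges G =
  [set [set i | (pet i == None) || (pet i == Some l)] | l : 'I_m].

Let r_gt0 : (0 < r)%N.
Proof. by rewrite r_def addn_gt0 k_gt0. Qed.

Let ex_pet (o : option 'I_m) : exists i, pet i == o.
Proof.
have /card_gt0P[i io] : (0 < #|[pred i | pet i == o]|)%N by rewrite card_pet; case: o.
by exists i.
Qed.

Definition class_prod (C : comPzRingType) (S : vertices G -> C) (o : option 'I_m) :=
  \prod_(i | pet i == o) S i.

(** The sum of [b l] over the edges through a vertex of class [o]: a kernel vertex lies on every
    edge, a petal vertex on one. *)
Definition petal_weight (C : comPzRingType) (b : 'I_m -> C) (o : option 'I_m) :=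
  if o is Some l then b l else \sum_l b l.

(** Multiplying by [S i] restores the missing factor of each edge product, which then splits into
    kernel and petal. *)
Lemma edge_sum_sunflower (C : comPzRingType) (S : vertices G -> C) (i : vertices G) :
  S i * edge_sum (edges G) S i =
  class_prod S None * petal_weight (fun l => class_prod S (Some l)) (pet i).
Proof.
(* Distinct indices give distinct edges because petals are nonempty. *)
rewrite /edge_sum edgesG big_mkcondr /= big_imset /=; last first.
  move=> l l' _ _ eqE; have [j pj] := ex_pet (Some l).
  have : j \in [set i | (pet i == None) || (pet i == Some l')].
    by rewrite -eqE inE pj orbT.
  by rewrite inE (eqP pj) /= => /eqP[].
rewrite -big_mkcondr big_distrr /=.
have prodE l : \prod_(j in [set j | (pet j == None) || (pet j == Some l)]) S j =
    class_prod S None * class_prod S (Some l).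
  rewrite (bigID (fun j => pet j == None)) /=; congr (_ * _); apply: eq_bigl => j.
    by rewrite inE; case: (pet j == None); rewrite ?andbF.
  by rewrite inE; case: (pet j) => [l'|] /=; rewrite ?andbT ?andbF.
rewrite (eq_bigr (fun l => class_prod S None * class_prod S (Some l))); last first.
  by move=> l il; rewrite -prodE [RHS](big_setD1 i).
rewrite -big_distrr /=; congr (_ * _).
rewrite (eq_bigl (fun l => (pet i == None) || (pet i == Some l))); last first.
  by move=> l; rewrite inE.
case: (pet i) => [l|] //=; apply: big_pred1 => l'.
by rewrite /= eq_sym.
Qed.

Section Radius.

Variable w : vertices G -> nat.
Hypothesis w_gt0 : forall j, (0 < w j)%N.

Definition class_weight (o : option 'I_m) : nat := \prod_(i | pet i == o) w i.

Definition exponent : R := (r - 1)%:R / k%:R.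

(* Its [k]-th power is the [r]-th power of the spectral radius. *)
Definition radius_power : R :=
  (class_weight None)%:R `^ exponent *
  \sum_(l < m) (class_weight (Some l))%:R `^ exponent.

Lemma class_weight_gt0 o : (0 < class_weight o)%N.
Proof. by apply: prodn_cond_gt0 => i _. Qed.

Lemma powR_exponent (x : R) : 0 <= x -> (x `^ exponent) ^+ k = x ^+ (r - 1).
Proof.
move=> x_ge0; rewrite -powR_mulrn ?powR_ge0 // -powRrM mulfVK ?powR_mulrn //.
by rewrite pnatr_eq0 -lt0n.
Qed.

Let phi l : R := (class_weight (Some l))%:R `^ exponent.

Let phi_gt0 l : 0 < phi l.
Proof. by rewrite powR_gt0 // ltr0n class_weight_gt0. Qed.

Lemma radius_power_gt0 : 0 < radius_power.
Proof.
rewrite mulr_gt0 //; first by rewrite powR_gt0 // ltr0n class_weight_gt0.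
rewrite (bigD1 (Ordinal m_gt0)) //= ltr_pwDl ?phi_gt0 // sumr_ge0 // => l _.
exact: powR_ge0.
Qed.

Lemma radius_power_expn :
  radius_power ^+ k = (class_weight None)%:R ^+ (r - 1) * (\sum_l phi l) ^+ k.
Proof. by rewrite exprMn powR_exponent. Qed.

(** Isolates the quantities [w i * y i ^ r], which the eigenvalue equations multiplied by
    [w i * y i] control. *)
Lemma class_prod_expn (y : vertices G -> R) o :
  class_prod (fun i => (w i)%:R * y i) o ^+ r =
  (class_weight o)%:R ^+ (r - 1) * \prod_(i | pet i == o) ((w i)%:R * y i ^+ r).
Proof.
rewrite -prodrXl natr_prod -prodrXl -big_split /=; apply: eq_bigr => i _.
by rewrite mulrA -exprSr -[in RHS]subSn // subSS subn0 exprMn.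
Qed.

(** Multiplying the inequalities over each class and cancelling powers gives
    [L^k A^q <= W_K^(r-1) (\sum B)^k] and [L^q B_l^k <= W_l^(r-1) A^q]. The [k]-th roots of the
    petal bounds can be summed over [l]; combined with the kernel bound, this leaves the factor
    [A^q] to cancel. *)
Lemma spectral_upper_bound (L : R) (y : vertices G -> R) :
  0 <= L -> (forall i, 0 <= y i) -> (exists i, 0 < y i) ->
  (let z i := (w i)%:R * y i in
   forall i, L * ((w i)%:R * y i ^+ r) <=
     class_prod z None * petal_weight (fun l => class_prod z (Some l)) (pet i)) ->
  L ^+ r <= radius_power ^+ k.
Proof.
rewrite le0r => /predU1P[-> | L_gt0] y_ge0 [i0 yi0] /=.
  by rewrite expr0n gtn_eqF //= exprn_ge0 // ltW // radius_power_gt0.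
set z := fun i => _; set A := class_prod z None; set B := fun l => class_prod z (Some l).
move=> bound.
have z_ge0 i : 0 <= z i by rewrite mulr_ge0.
have A_ge0 : 0 <= A by apply: prodr_ge0.
have B_ge0 l : 0 <= B l by apply: prodr_ge0.
(* If [A] vanished, the inequality at a vertex with [y i0 > 0] would fail. *)
have A_gt0 : 0 < A.
  rewrite lt0r A_ge0 andbT; apply/eqP => A0.
  have := bound i0; rewrite A0 mul0r leNgt; apply/negP; rewrite negbK.
  by rewrite mulr_gt0 // mulr_gt0 ?ltr0n // exprn_gt0.
have class_bound o : L ^+ (if o is Some _ then q else k) * class_prod z o ^+ r <=
    (class_weight o)%:R ^+ (r - 1) *
    (A * petal_weight B o) ^+ (if o is Some _ then q else k).
  rewrite class_prod_expn mulrCA ler_wpM2l ?exprn_ge0 //.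
  rewrite -(card_pet o) -!prodr_const -big_split /=; apply: ler_prod => i /eqP <-.
  by rewrite bound andbT mulr_ge0 ?(ltW L_gt0) // mulr_ge0 // exprn_ge0.
have kernel_bound : L ^+ k * A ^+ q <= (class_weight None)%:R ^+ (r - 1) * (\sum_l B l) ^+ k.
  have := class_bound None; rewrite /= -/A r_def exprD exprMn.
  by rewrite !(mulrCA _ (A ^+ k)) ler_pM2l ?exprn_gt0.
have petal_bound l : L ^+ q * B l ^+ k <= (class_weight (Some l))%:R ^+ (r - 1) * A ^+ q.
  have := B_ge0 l; rewrite le0r => /predU1P[-> | Bl_gt0].
    by rewrite expr0n gtn_eqF // mulr0 mulr_ge0 // exprn_ge0.
  have := class_bound (Some l); rewrite /= -/(B l) r_def exprD exprMn.
  by rewrite !mulrA ler_pM2r ?exprn_gt0.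
(* [mu] and [a] stand for [L^(q/k)] and [A^(q/k)]. *)
have [mu mu_ge0 muE] := exists_root k_gt0 (ltW (exprn_gt0 q L_gt0)).
have [a a_ge0 aE] := exists_root k_gt0 (ltW (exprn_gt0 q A_gt0)).
have sum_bound : mu * \sum_l B l <= (\sum_l phi l) * a.
  rewrite big_distrr big_distrl /=; apply: ler_sum => l _.
  rewrite -(@ler_pXn2r _ k) ?nnegrE ?mulr_ge0 ?(ltW (phi_gt0 _)) //.
  by rewrite !exprMn muE aE powR_exponent.
have sumB_ge0 : 0 <= \sum_l B l by apply: sumr_ge0.
have sumphi_ge0 : 0 <= \sum_l phi l by apply: sumr_ge0 => l _; exact: ltW.
rewrite radius_power_expn -(@ler_pM2r _ (A ^+ q)) ?exprn_gt0 //.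
rewrite {1}r_def addnC exprD -mulrA.
apply: (le_trans (y := L ^+ q * ((class_weight None)%:R ^+ (r - 1) * (\sum_l B l) ^+ k))).
  by rewrite ler_wpM2l // exprn_ge0 // ltW.
rewrite mulrCA -mulrA ler_wpM2l ?exprn_ge0 // -muE -aE -!exprMn.
by rewrite lerXn2r // nnegrE mulr_ge0.
Qed.

(* The vector is determined by [w i * y i ^ r = phi l] on the petal [l] and
   [w i * y i ^ r = \sum_l phi l] on the kernel. *)
Lemma perron_vector (rho : R) :
  0 <= rho -> rho ^+ r = radius_power ^+ k ->
  exists2 y : vertices G -> R, forall i, 0 < y i &
    forall i, edge_sum (edges G) (fun i => (w i)%:R * y i) i = rho * y i ^+ r.-1.
Proof.
move=> rho_ge0 rhoE.
have c_gt0 o : 0 < petal_weight phi o.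
  case: o => [l|] /=; first exact: phi_gt0.
  rewrite (bigD1 (Ordinal m_gt0)) //= ltr_pwDl ?phi_gt0 // sumr_ge0 // => l _.
  exact: powR_ge0.
have cw_ge0 i : 0 <= petal_weight phi (pet i) / (w i)%:R by rewrite divr_ge0 // ltW.
pose y i := (petal_weight phi (pet i) / (w i)%:R) `^ r%:R^-1.
have yE i : (w i)%:R * y i ^+ r = petal_weight phi (pet i).
  rewrite -powR_mulrn ?powR_ge0 // -powRrM mulVf ?powRr1 //.
    by rewrite mulrCA divff ?mulr1 // pnatr_eq0 -lt0n.
  by rewrite pnatr_eq0 -lt0n.
have y_gt0 i : 0 < y i by rewrite powR_gt0 // divr_gt0 // ltr0n.
exists y => // i; set z := fun i => _.
have z_gt0 j : 0 < z j by rewrite mulr_gt0 // ltr0n.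
have zprodE o : class_prod z o ^+ r = (class_weight o)%:R ^+ (r - 1) *
    petal_weight phi o ^+ (if o is Some _ then q else k).
  rewrite class_prod_expn; congr (_ * _); rewrite -card_pet -prodr_const.
  by apply: eq_bigr => j /eqP <-.
have zprod_ge0 o : 0 <= class_prod z o by apply: prodr_ge0 => j _; exact: ltW.
(* With this [y] the kernel product is [rho] and each petal product is [phi l], so the equation at
   [i], multiplied by [z i], is [yE] times [rho]. *)
have AE : class_prod z None = rho.
  by apply/eqP; rewrite -(@eqrXn2 _ r) // zprodE rhoE radius_power_expn.
have BE l : class_prod z (Some l) = phi l.
  apply/eqP; rewrite -(@eqrXn2 _ r) //; last exact: ltW.
  by rewrite zprodE /= -powR_exponent // -exprD -r_def.
apply: (mulfI (lt0r_neq0 (z_gt0 i))); rewrite edge_sum_sunflower AE.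
have -> : petal_weight (fun l => class_prod z (Some l)) (pet i) = petal_weight phi (pet i).
  by case: (pet i) => [l|] /=; [exact: BE | apply: eq_bigr => l _; exact: BE].
by rewrite -yE /z -{1}(prednK r_gt0) exprS; ring.
Qed.

(** The norm of [R[i]] takes its values in [R[i]]; this is the same modulus as a real number. *)
Let cnorm (z : R[i]) : R := Num.sqrt (complex.Re z ^+ 2 + complex.Im z ^+ 2).

Let cnormE (z : R[i]) : `|z| = (cnorm z)%:C%C.
Proof. exact: normc_def. Qed.

Let cnorm_ge0 z : 0 <= cnorm z.
Proof. exact: sqrtr_ge0. Qed.

Let cnormM : {morph cnorm : a b / a * b}.
Proof. by move=> a b; apply: complexI; rewrite -cnormE normrM !cnormE -rmorphM. Qed.

Let cnormX z n : cnorm (z ^+ n) = cnorm z ^+ n.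
Proof. by apply: complexI; rewrite -cnormE normrX cnormE -rmorphXn. Qed.

(** [perron_vector], extended constantly on classes, realizes [rho]. For any other eigenpair, the
    triangle inequality turns the equations into the hypotheses of [spectral_upper_bound] for the
    moduli. *)
Lemma sunflower_spectral_radius (rho : R) :
  0 <= rho -> rho ^+ r = radius_power ^+ k -> is_spectral_radius (blowup G w) rho.
Proof.
move=> rho_ge0 rhoE; split.
  exists rho%:C%C; last by rewrite normc_def /= expr0n addr0 sqrtr_sqr ger0_norm.
  have [y y_gt0 yE] := perron_vector rho_ge0 rhoE.
  exists (fun u => (y (tag u))%:C%C).
    have [i _] := ex_pet None.
    exists (Tagged (fun j => 'I_(w j)) (Ordinal (w_gt0 i))) => /=.
    by rewrite (fmorph_eq0 (real_complex R)) gt_eqF.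
  move=> u; rewrite adjacency_tensor_sum //= edge_sum_blowup //.
  rewrite -rmorphXn -rmorphM -yE /edge_sum rmorph_sum; apply: eq_bigr => e _.
  rewrite rmorph_prod; apply: eq_bigr => j _.
  rewrite (eq_bigr (fun=> (y j)%:C%C)); last by move=> v /eqP ->.
  rewrite sumr_const rmorphM rmorph_nat mulr_natl; congr (_ *+ _).
  exact: card_blowup_class.
move=> lambda [x [u0 xu0] eigx]; rewrite cnormE lecR.
set L := cnorm lambda.
have L_ge0 : 0 <= L by apply: sqrtr_ge0.
rewrite -(@ler_pXn2r _ r) // rhoE.
(* The eigenvalue zero is treated apart: constancy of the moduli on classes is obtained by dividing
   by [L]. *)
have [-> | L_neq0] := eqVneq L 0.
  by rewrite expr0n gtn_eqF //= exprn_ge0 // ltW // radius_power_gt0.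
pose v0 j : {j & 'I_(w j)} := Tagged (fun j => 'I_(w j)) (Ordinal (w_gt0 j)).
pose S j := \sum_(u | tag u == j) x u.
have eigS u : edge_sum (edges G) S (tag u) = lambda * x u ^+ r.-1.
  by rewrite -eigx adjacency_tensor_sum //= edge_sum_blowup.
(* The edge sum depends only on the class of [u], hence so does [lambda * x u ^+ r.-1]. *)
have eq_cnorm u : cnorm (x u) = cnorm (x (v0 (tag u))).
  apply/eqP; rewrite -(@eqrXn2 _ r.-1) ?cnorm_ge0 //; last first.
    by rewrite -subn1 subn_gt0 r_def; lia.
  by apply/eqP/(mulfI L_neq0); rewrite -!cnormX -!cnormM -!eigS.
apply: (spectral_upper_bound (y := fun j => cnorm (x (v0 j)))) => // [|z j].
  exists (tag u0); rewrite -eq_cnorm lt0r cnorm_ge0 andbT.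
  by apply: contraNneq xu0 => xu0; rewrite -normr_eq0 cnormE xu0.
have -> : L * ((w j)%:R * cnorm (x (v0 j)) ^+ r) = z j * (L * cnorm (x (v0 j)) ^+ r.-1).
  by rewrite -{1}(prednK r_gt0) exprS /z; ring.
rewrite -edge_sum_sunflower.
rewrite ler_wpM2l ?mulr_ge0 ?cnorm_ge0 //.
rewrite -cnormX -cnormM -(eigS (v0 j)) -lecR -cnormE /=.
apply: (le_trans (ler_norm_sum _ _ _)); rewrite rmorph_sum; apply: ler_sum => e _.
rewrite normr_prod rmorph_prod; apply: ler_prod => i _; rewrite normr_ge0 /=.
apply: (le_trans (ler_norm_sum _ _ _)).
rewrite (eq_bigr (fun=> (cnorm (x (v0 i)))%:C%C)); last first.
  by move=> u /eqP <-; rewrite cnormE eq_cnorm.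
by rewrite sumr_const card_blowup_class /z rmorphM rmorph_nat mulr_natl.
Qed.

End Radius.

(** * Comparison of spectral radii through [radius_power] *)

Lemma spectral_radius_expn (w : vertices G -> nat) (rho : R) :
  (forall j, 0 < w j)%N -> is_spectral_radius (blowup G w) rho ->
  0 <= rho /\ rho ^+ r = radius_power w ^+ k.
Proof.
move=> w_gt0 rho_w.
have [rho' rho'_ge0 rho'E] := exists_root r_gt0 (exprn_ge0 k (ltW (radius_power_gt0 w_gt0))).
have rho'_w := sunflower_spectral_radius w_gt0 rho'_ge0 rho'E.
by rewrite (is_spectral_radius_uniq rho_w rho'_w).
Qed.

Lemma exists_spectral_radius (w : vertices G -> nat) :
  (forall j, 0 < w j)%N -> exists rho : R, is_spectral_radius (blowup G w) rho.
Proof.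
move=> w_gt0.
have [rho rho_ge0 rhoE] := exists_root r_gt0 (exprn_ge0 k (ltW (radius_power_gt0 w_gt0))).
by exists rho; apply: sunflower_spectral_radius.
Qed.

Lemma spectral_radius_le (w v : vertices G -> nat) (rho rho' : R) :
  (forall j, 0 < w j)%N -> (forall j, 0 < v j)%N ->
  is_spectral_radius (blowup G w) rho -> is_spectral_radius (blowup G v) rho' ->
  (rho <= rho') = (radius_power w <= radius_power v).
Proof.
move=> w_gt0 v_gt0 /(spectral_radius_expn w_gt0)[rho_ge0 rhoE].
move=> /(spectral_radius_expn v_gt0)[rho'_ge0 rho'E].
rewrite -(@ler_pXn2r _ r) // rhoE rho'E ler_pXn2r // nnegrE ltW //.
  exact: radius_power_gt0.
exact: radius_power_gt0.
Qed.

(** Obtained from the invariance of the spectral radius, without tracing what the isomorphism does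
    to the classes. *)
Lemma radius_power_isomorphic (w v : vertices G -> nat) :
  (forall j, 0 < w j)%N -> (forall j, 0 < v j)%N ->
  isomorphic (blowup G w) (blowup G v) -> radius_power w = radius_power v.
Proof.
move=> w_gt0 v_gt0 iso_wv; have [rho rho_w] := exists_spectral_radius w_gt0.
have rho_v := is_spectral_radius_isomorphic r_gt0 iso_wv rho_w.
apply/eqP; rewrite eq_le -(spectral_radius_le w_gt0 v_gt0 rho_w rho_v).
by rewrite -(spectral_radius_le v_gt0 w_gt0 rho_v rho_w) lexx.
Qed.

Variable n : nat.

Lemma attains_minE (w : vertices G -> nat) :
  blowup_vector G n w ->
  (attains_min_spectral_radius R (blowups G n) (blowup G w) <->
   forall v, blowup_vector G n v -> radius_power w <= radius_power v).
Proof.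
move=> w_vec; have [w_gt0 _] := w_vec; split=> [[_ [rho rho_w rho_min]] v v_vec | w_min].
  have [|rho' rho_v] := rho_min (blowup G v); first by exists v.
  by rewrite (spectral_radius_le w_gt0 _ rho_w rho_v) //; case: v_vec.
split; first by exists w.
have [rho rho_w] := exists_spectral_radius w_gt0.
exists rho => // _ [v v_vec ->]; have [v_gt0 _] := v_vec.
have [rho' rho_v] := exists_spectral_radius v_gt0.
by exists rho' => //; rewrite (spectral_radius_le w_gt0 v_gt0 rho_w rho_v) w_min.
Qed.

Lemma attains_maxE (w : vertices G -> nat) :
  blowup_vector G n w ->
  (attains_max_spectral_radius R (blowups G n) (blowup G w) <->
   forall v, blowup_vector G n v -> radius_power v <= radius_power w).
Proof.
move=> w_vec; have [w_gt0 _] := w_vec; split=> [[_ [rho rho_w rho_max]] v v_vec | w_max].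
  have [|rho' rho_v] := rho_max (blowup G v); first by exists v.
  by rewrite (spectral_radius_le _ w_gt0 rho_v rho_w) //; case: v_vec.
split; first by exists w.
have [rho rho_w] := exists_spectral_radius w_gt0.
exists rho => // _ [v v_vec ->]; have [v_gt0 _] := v_vec.
have [rho' rho_v] := exists_spectral_radius v_gt0.
by exists rho' => //; rewrite (spectral_radius_le v_gt0 w_gt0 rho_v rho_w) w_max.
Qed.

Lemma sunflower_automorphism (w : vertices G -> nat) (s : vertices G -> vertices G)
    (h : 'I_m -> 'I_m) :
  involutive s -> (forall i, pet (s i) = omap h (pet i)) ->
  isomorphic (blowup G w) (blowup G (fun i => w (s i))).
Proof.
move=> sK pet_s; apply: blowup_automorphism => // e; rewrite edgesG => /imsetP[l _ ->].
apply/imsetP; exists (h l) => //; apply/setP => j.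
(* [h] inherits injectivity from the involution [s], as every petal has a vertex. *)
have h_inj l1 l2 : h l1 = h l2 -> l1 = l2.
  have [i1 /eqP i1P] := ex_pet (Some l1); have [i2 /eqP i2P] := ex_pet (Some l2) => h12.
  have : pet (s (s i1)) = pet (s (s i2)) by rewrite !pet_s i1P i2P /= h12.
  by rewrite !sK i1P i2P => -[].
have pet_h i : (pet (s i) == None) || (pet (s i) == Some (h l)) =
    ((pet i == None) || (pet i == Some l)).
  rewrite pet_s; case: (pet i) => [l'|] //=.
  by apply/eqP/eqP => [[/h_inj ->] | [->]].
rewrite inE -[j]sK pet_h; apply/imsetP/idP => [[i0] | js].
  by rewrite inE => iP /(inv_inj sK) ->.
by exists (s j); rewrite ?inE.
Qed.

Lemma sum_classes (F : vertices G -> nat) :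
  (\sum_i F i = \sum_(i | pet i == None) F i + \sum_l \sum_(i | pet i == Some l) F i)%N.
Proof.
rewrite (partition_big pet xpredT) //= (bigD1 None) //=; congr (_ + _)%N.
rewrite (reindex_omap Some id) => [|[l _|]] //=.
by apply: eq_bigl => l; rewrite eqxx.
Qed.

Lemma sum_class_const (o : option 'I_m) (c : nat) :
  (\sum_(i | pet i == o) c = (if o is Some _ then q else k) * c)%N.
Proof. by rewrite sum_nat_const -(card_pet o). Qed.

Lemma class_weight1 (w : vertices G -> nat) o :
  (forall i, pet i == o -> w i = 1%N) -> class_weight w o = 1%N.
Proof. exact: big1. Qed.

Lemma class_weight1P (w : vertices G -> nat) o :
  class_weight w o = 1%N -> forall i, pet i == o -> w i = 1%N.
Proof.
move=> w1 i io; apply/eqP; rewrite -dvdn1 -w1.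
by rewrite /class_weight (bigD1 i) //= dvdn_mulr.
Qed.

Hypotheses (q_gt1 : (1 < q)%N) (m_gt1 : (1 < m)%N) (t_le_n : (k + m * q <= n)%N).
(** The vertex that carries the whole excess of its petal in a normalized minimizer. *)
Variable last : 'I_m -> vertices G.
Hypothesis pet_last : forall l, pet (last l) = Some l.
Variable swap : 'I_m -> 'I_m -> vertices G -> vertices G.
Hypothesis swapK : forall l1 l2, involutive (swap l1 l2).
Hypothesis pet_swap : forall l1 l2 i, pet (swap l1 l2 i) = omap (tperm l1 l2) (pet i).

Let f (x : nat) : R := x%:R `^ exponent.

Let exponent_gt1 : 1 < exponent.
Proof.
rewrite /exponent ltr_pdivlMr ?ltr0n // mul1r ltr_nat r_def.
by move: k_gt0 q_gt1; lia.
Qed.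

Let f1 : f 1 = 1.
Proof. by rewrite /f powR1. Qed.

Let f_gt0 x : (0 < x)%N -> 0 < f x.
Proof. by move=> x_gt0; rewrite powR_gt0 // ltr0n. Qed.

Let fM x y : f (x * y) = f x * f y.
Proof. by rewrite /f natrM powRM. Qed.

Let f_lt x y : (x < y)%N -> f x < f y.
Proof.
move=> xy; apply: gt0_ltr_powR; rewrite ?nnegrE // ?ltr_nat //.
exact: lt_trans exponent_gt1.
Qed.

Let f_le x y : (x <= y)%N -> f x <= f y.
Proof. by rewrite leq_eqVlt => /predU1P[-> // | /f_lt /ltW]. Qed.

Let f_convex : strictly_convex_seq f := powR_strictly_convex exponent_gt1.

Let radius_powerE w :
  radius_power w = f (class_weight w None) * \sum_l f (class_weight w (Some l)).
Proof. by []. Qed.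

(** * The minimum: lower bound and equality case *)

Lemma sum_excess (w : vertices G -> nat) :
  blowup_vector G n w -> (\sum_i (w i).-1 = n - (k + m * q))%N.
Proof.
case=> w_gt0 <-; have -> : (\sum_i w i = \sum_i (w i).-1 + \sum_(i : vertices G) 1)%N.
  by rewrite -big_split; apply: eq_bigr => i _; rewrite /= addn1 prednK.
have -> : (\sum_(i : vertices G) 1 = k + m * q)%N.
  rewrite sum_classes sum_class_const muln1 (eq_bigr (fun=> q)); last first.
    by move=> l _; rewrite sum_class_const muln1.
  by rewrite sum_nat_const card_ord.
by rewrite addnK.
Qed.

Let excess := (n - (k + m * q))%N.
Let base := (excess %/ m).+1.
(* The sum over the petals of the chord of [f] through [base] and [base.+1];
   by strict convexity it is attained only by values in [base], [base.+1]. *)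
Let min_power : R :=
  m%:R * f base + ((excess + m)%:R - m%:R * base%:R) * (f base.+1 - f base).

(** The chord has positive slope, so a total above [excess + m] only raises the bound of
    [convex_seq_sum]. *)
Let sum_f_ge (x : 'I_m -> nat) :
  (forall l, (0 < x l)%N) -> (excess + m <= \sum_l x l)%N ->
  min_power <= \sum_l f (x l)
  ?= iff (\sum_l x l == excess + m)%N && [forall l, (x l == base) || (x l == base.+1)].
Proof.
move=> x_gt0 x_sum.
have d_gt0 : 0 < f base.+1 - f base by rewrite subr_gt0 f_lt.
have h := @convex_seq_sum _ f f_convex _ predT x base isT (fun i _ => x_gt0 i).
rewrite card_ord in h; apply: leif_trans h.
rewrite (mono_leif (lerD2l _)) (mono_leif (ler_pM2r d_gt0)) (mono_leif (lerD2r _)).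
by split; rewrite ?ler_nat // eqr_nat eq_sym.
Qed.

Lemma radius_power_min (w : vertices G -> nat) :
  blowup_vector G n w ->
  min_power <= radius_power w /\
  (radius_power w = min_power ->
    [/\ class_weight w None = 1%N,
        (\sum_l class_weight w (Some l) = excess + m)%N &
        forall l, class_weight w (Some l) = base \/ class_weight w (Some l) = base.+1]).
Proof.
move=> w_vec; have [w_gt0 _] := w_vec; have excessE := sum_excess w_vec.
pose l0 := Ordinal m_gt0; set W := class_weight w.
have W_gt0 o : (0 < W o)%N by apply: class_weight_gt0.
have W_gt o : (\sum_(i | pet i == o) (w i).-1 < W o)%N by apply: prod_gt_sum.
(* The kernel weight is absorbed into the single petal [l0]. This does not increase the value, since
   [f] is multiplicative and the other petals lose a factor [f (W None) >= 1], and it keeps the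
   total at least [excess + m]. *)
pose x l := if l == l0 then (W None * W (Some l))%N else W (Some l).
have x_gt0 l : (0 < x l)%N by rewrite /x; case: ifP => _ //; rewrite muln_gt0 !W_gt0.
have x_le l : f (x l) <= f (W None) * f (W (Some l)).
  rewrite -fM f_le // /x; case: ifP => // _.
  by rewrite leq_pmull.
have x_sum : (excess + m <= \sum_l x l)%N.
  rewrite /excess -excessE sum_classes (bigD1 l0) //= [leqRHS](bigD1 l0) //= {1}/x eqxx.
  have := W_gt None; have := W_gt (Some l0).
  have : (\sum_(l | l != l0) \sum_(i | pet i == Some l) (w i).-1 + m.-1
            <= \sum_(l | l != l0) x l)%N.
    have -> : m.-1 = (\sum_(l | l != l0) 1)%N.
      by rewrite sum1_card cardC1 card_ord.
    rewrite -big_split /=; apply: leq_sum => l ll0.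
    by rewrite /x (negPf ll0) addn1.
  have : (W None + W (Some l0) <= (W None * W (Some l0)).+1)%N.
    by move: (W_gt0 None) (W_gt0 (Some l0)); case: (W None) => // a; case: (W _) => // b; nia.
  move: m_gt0 (W None) (W (Some l0)) (W None * W (Some l0))%N (\sum_(l | _) x l)%N.
  set a := (\sum_(i | _ == None) _)%N; set b := (\sum_(i | _ == Some l0) _)%N.
  by move: (\sum_(l | _) \sum_(i | _) _)%N a b; lia.
have [sum_ge sum_eq] := sum_f_ge x_gt0 x_sum.
have sum_le : \sum_l f (x l) <= radius_power w.
  by rewrite radius_powerE big_distrr; apply: ler_sum.
split=> [|rp_min]; first exact: le_trans sum_le.
have sum_min : min_power == \sum_l f (x l).
  by rewrite eq_le sum_ge -rp_min.
have WK : W None = 1%N.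
  apply/eqP; rewrite eqn_leq W_gt0 andbT leqNgt; apply/negP => WK.
  have : \sum_l f (x l) < radius_power w.
    (* A second petal: there the lost factor [f (W None)] makes the inequality strict. *)
    pose l1 := Ordinal m_gt1.
    rewrite radius_powerE big_distrr /= (bigD1 l1) //= [ltRHS](bigD1 l1) //=.
    apply: ltr_leD; last by apply: ler_sum.
    by rewrite -fM f_lt // /x /= ltn_Pmull.
  by rewrite -(eqP sum_min) rp_min ltxx.
have xE l : x l = W (Some l) by rewrite /x WK mul1n; case: ifP.
rewrite sum_min in sum_eq; case/esym/andP: sum_eq => /eqP sum_x /forallP bal.
split=> // [|l]; first by rewrite -sum_x; apply: eq_bigr => l _; rewrite xE.
by have := bal l; rewrite xE => /orP[] /eqP; [left | right].
Qed.

Definition spread (e : 'I_m -> nat) (i : vertices G) : nat :=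
  if pet i is Some l then if i == last l then e l else 1%N else 1%N.

Lemma spread_kernel e i : pet i == None -> spread e i = 1%N.
Proof. by rewrite /spread => /eqP ->. Qed.

Lemma spread_petal e l i : pet i == Some l -> spread e i = if i == last l then e l else 1%N.
Proof. by rewrite /spread => /eqP ->. Qed.

Lemma class_weight_spread e o :
  class_weight (spread e) o = if o is Some l then e l else 1%N.
Proof.
case: o => [l|]; last by apply: class_weight1 => i; apply: spread_kernel.
rewrite /class_weight (bigD1 (last l)) ?pet_last //=.
rewrite (spread_petal e (l := l)) ?pet_last // eqxx big1 ?muln1 // => i /andP[il /negPf].
by rewrite (spread_petal e il) => ->.
Qed.

Lemma blowup_vector_spread e :
  (forall l, 0 < e l)%N -> (\sum_l e l = excess + m)%N -> blowup_vector G n (spread e).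
Proof.
move=> e_gt0 sum_e; split=> [i0|].
  by rewrite /spread; case: (pet i0) => // l; case: ifP.
rewrite sum_classes (eq_bigr (fun=> 1%N)) => [|i0]; last exact: spread_kernel.
rewrite sum_class_const muln1.
rewrite (eq_bigr (fun l => e l + q.-1)%N); last first.
  move=> l _; rewrite (bigD1 (last l)) ?pet_last //=.
  rewrite (spread_petal e (l := l)) ?pet_last // eqxx; congr (_ + _)%N.
  rewrite (eq_bigr (fun=> 1%N)); last first.
    by move=> i0 /andP[il /negPf]; rewrite (spread_petal e il) => ->.
  have := sum_class_const (Some l) 1; rewrite (bigD1 (last l)) ?pet_last //= muln1.
  by rewrite add1n => <-.
rewrite big_split /= sum_e sum_nat_const card_ord /excess.
move: t_le_n q_gt0 m_gt0; nia.
Qed.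

Lemma radius_power_spread e :
  (\sum_l e l = excess + m)%N -> (forall l, e l = base \/ e l = base.+1) ->
  radius_power (spread e) = min_power.
Proof.
move=> sum_e bal; rewrite radius_powerE class_weight_spread f1 mul1r.
rewrite (eq_bigr (fun l => f (e l))); last by move=> l _; rewrite class_weight_spread.
have e_gt0 l : (0 < e l)%N by case: (bal l) => ->.
have [//|_] := sum_f_ge e_gt0 _; first by rewrite sum_e.
rewrite sum_e eqxx /=; set b := [forall _, _]; have -> : b.
  by apply/forallP => l; case: (bal l) => ->; rewrite eqxx ?orbT.
by move/eqP.
Qed.

Lemma exists_spread : exists2 e : 'I_m -> nat, (\sum_l e l = excess + m)%N &
  forall l, e l = base \/ e l = base.+1.
Proof.
have [|e /forall_inP bal sum_e] := @exists_balanced _ (predT : pred 'I_m) (excess + m)%N.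
  by rewrite card_ord.
exists e => // l; have := bal l isT; rewrite card_ord divnDr // divnn m_gt0 addn1.
by move=> /orP[] /eqP; [left | right].
Qed.

(** Equality in [radius_power_min] makes the kernel trivial and forces equality in [prod_gt_sum] on
    every petal, so each petal has at most one vertex of size above 1; a transposition moves it to
    [last]. *)
Lemma minimizer_structure (w : vertices G -> nat) :
  blowup_vector G n w ->
  (forall v, blowup_vector G n v -> radius_power w <= radius_power v) ->
  exists e : 'I_m -> nat, exists s : vertices G -> vertices G,
    [/\ (\sum_l e l = excess + m)%N, forall l, e l = base \/ e l = base.+1,
        involutive s, forall i, pet (s i) = pet i & forall i, w (s i) = spread e i].
Proof.
move=> w_vec w_min; have [w_gt0 _] := w_vec.
have [rp_ge rp_eq] := radius_power_min w_vec.
have [e0 sum_e0 bal0] := exists_spread.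
have e0_gt0 l : (0 < e0 l)%N by case: (bal0 l) => ->.
have {}rp_eq := rp_eq _; have [] := rp_eq.
  apply/eqP; rewrite eq_le rp_ge andbT -(radius_power_spread sum_e0 bal0).
  exact/w_min/blowup_vector_spread.
set W := class_weight w => WK sumW balW.
have kernel1 := class_weight1P WK.
(* The inequality holds petal by petal and the totals agree, so each one is an equality. *)
have WE l : W (Some l) = (\sum_(i | pet i == Some l) (w i).-1).+1.
  have W_gt l' : (\sum_(i | pet i == Some l') (w i).-1 < W (Some l'))%N by apply: prod_gt_sum.
  have : (\sum_l W (Some l) = \sum_l (\sum_(i | pet i == Some l) (w i).-1).+1)%N.
    rewrite sumW /excess -(sum_excess w_vec) sum_classes big1 ?add0n; last first.
      by move=> i /kernel1 ->.
    under [RHS]eq_bigr do rewrite -addn1.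
    by rewrite big_split /= sum1_card card_ord.
  rewrite (bigD1 l) //= [RHS](bigD1 l) //=.
  have : (\sum_(l' | l' != l) (\sum_(i | pet i == Some l') (w i).-1).+1
            <= \sum_(l' | l' != l) W (Some l'))%N by apply: leq_sum.
  move: (W_gt l); set a := (\sum_(i | _) (w i).-1)%N.
  by move: (\sum_(l' | _) W _)%N (\sum_(l' | _) _.+1)%N a (W _); lia.
have one_of l := @prod_eq_sum _ (fun i => pet i == Some l) w (fun i _ => w_gt0 i) (WE l).
(* The blown-up vertex of petal [l], or [last l] if all sizes are 1. *)
pose c l := odflt (last l) [pick i | (pet i == Some l) && (w i != 1%N)].
have pet_c l : pet (c l) = Some l.
  by rewrite /c; case: pickP => [i /andP[/eqP //] | _] /=.
have not_c l i : pet i == Some l -> i != c l -> w i = 1%N.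
  rewrite /c; case: pickP => [j /andP[jl wj] | no] /= il ij.
    by case: (one_of l i j il jl ij) => // wj1; rewrite wj1 eqxx in wj.
  by have := no i; rewrite il /= => /negbFE /eqP.
have w_c l : w (c l) = W (Some l).
  rewrite /W /class_weight (bigD1 (c l)) /= ?pet_c // big1 ?muln1 // => i /andP[il ic].
  exact: not_c ic.
pose s i := if pet i is Some l then tperm (c l) (last l) i else i.
have pet_s i : pet (s i) = pet i.
  rewrite /s; case il: (pet i) => [l|] //.
  by case: tpermP => // _; rewrite ?pet_c ?pet_last.
exists (fun l => W (Some l)), s; split=> // i.
  by rewrite {1}/s pet_s /s; case: (pet i) => // l; rewrite tpermK.
rewrite /spread /s; case il: (pet i) => [l|]; last by rewrite kernel1 ?il.
case: ifP => [/eqP -> | /negbT i_last]; first by rewrite tpermR w_c.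
apply: (not_c l).
  by case: tpermP => [||//]; rewrite ?pet_c ?pet_last ?il.
apply: contraNneq i_last => /(congr1 (tperm (c l) (last l))).
by rewrite tpermK tpermL => ->.
Qed.

(** * The maximum: concentration on one petal and balancing *)

Lemma merge_petals (w : vertices G -> nat) (l1 l2 : 'I_m) :
  blowup_vector G n w -> l1 != l2 ->
  (1 < class_weight w (Some l1))%N -> (1 < class_weight w (Some l2))%N ->
  exists2 v, blowup_vector G n v & radius_power w < radius_power v.
Proof.
move=> [w_gt0 sum_w] l12 W1 W2; pose s := swap l1 l2.
have pet_s i : (pet (s i) == Some l1) = (pet i == Some l2).
  rewrite pet_swap; case: (pet i) => [l|] //=.
  rewrite !(inj_eq Some_inj) -(inj_eq (@perm_inj _ (tperm l1 l2)) (tperm l1 l2 l)).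
  by rewrite tpermK tpermL.
(* The excess of petal [l1] moves onto [l2], vertex by vertex along [swap]. *)
pose v i := if pet i == Some l1 then 1%N else
  if pet i == Some l2 then (w i + (w (s i)).-1)%N else w i.
have v1 i : pet i == Some l1 -> v i = 1%N by rewrite /v => ->.
have v2 i : pet i == Some l2 -> v i = (w i + (w (s i)).-1)%N.
  by rewrite /v => il; rewrite il (eqP il) (inj_eq Some_inj) eq_sym (negPf l12).
have v0 o i : o != Some l1 -> o != Some l2 -> pet i == o -> v i = w i.
  by rewrite /v => o1 o2 /eqP ->; rewrite (negPf o1) (negPf o2).
have sum_shift (F : nat -> nat) :
    (\sum_(i | pet i == Some l2) F (w (s i)) = \sum_(i | pet i == Some l1) F (w i))%N.
  rewrite [RHS](reindex_inj (inv_inj (swapK l1 l2))) /=; apply: eq_bigl => i.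
  by rewrite -pet_s.
have prod_shift :
    (\prod_(i | pet i == Some l2) w (s i) = class_weight w (Some l1))%N.
  rewrite /class_weight [RHS](reindex_inj (inv_inj (swapK l1 l2))) /=; apply: eq_bigl => i.
  by rewrite -pet_s.
have v_gt0 i : (0 < v i)%N by rewrite /v; do 2?case: ifP => // _; rewrite ?addn_gt0 w_gt0.
have l21 : l2 != l1 by rewrite eq_sym.
exists v.
  split=> //; rewrite -sum_w !sum_classes; congr (_ + _)%N.
    by apply: eq_bigr => i; apply: v0.
  rewrite (bigD1 l1) // (bigD1 l2) //= [RHS](bigD1 l1) // [in RHS](bigD1 l2) //= !addnA.
  congr (_ + _)%N; last first.
    apply: eq_bigr => l /andP[ll1 ll2]; apply: eq_bigr => i.
    by apply: v0; rewrite (inj_eq Some_inj).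
  rewrite (eq_bigr (fun=> 1%N)) //.
  rewrite [X in (_ + X)%N](eq_bigr (fun i => w i + (w (s i)).-1)%N) //.
  rewrite big_split /= (sum_shift predn) sum_class_const.
  rewrite addnCA [RHS]addnC; congr (_ + _)%N.
  rewrite -(sum_class_const (Some l1)) -big_split /=; apply: eq_bigr => i _.
  by rewrite add1n prednK.
rewrite !radius_powerE.
have VK : class_weight v None = class_weight w None.
  by apply: eq_bigr => i; apply: v0.
rewrite VK ltr_pM2l ?f_gt0 ?class_weight_gt0 //.
rewrite (bigD1 l1) // (bigD1 l2) //= [ltRHS](bigD1 l1) // [in ltRHS](bigD1 l2) //= !addrA.
rewrite [in ltRHS](eq_bigr (fun l => f (class_weight w (Some l)))); last first.
  move=> l /andP[ll1 ll2]; congr f; apply: eq_bigr => i.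
  by apply: v0; rewrite (inj_eq Some_inj).
rewrite ltrD2r (class_weight1 v1) f1.
have V2 : (class_weight w (Some l1) + class_weight w (Some l2)
             <= (class_weight v (Some l2)).+1)%N.
  rewrite -prod_shift addnC.
  have := @prod_merge _ (fun i => pet i == Some l2) w (fun i => w (s i))
    (fun i _ => w_gt0 i) (fun i _ => w_gt0 (s i)).
  by congr (_ <= _.+1)%N; apply: eq_bigr => i il; rewrite v2.
set x := class_weight w (Some l1) in W1 V2 *.
set y := class_weight w (Some l2) in W2 V2 *.
(* Increments of length [y - 1] from 1 and from [x] compare to [f x + f y < f 1 + f (x + y - 1)]. *)
have h := @convex_seq_shift _ f f_convex 1 x y.-1 isT W1.
have {h} := h ltac:(lia); rewrite f1 add1n prednK; last by lia.
have : f (x + y.-1) <= f (class_weight v (Some l2)) by apply: f_le; lia.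
by move=> h1 h2; lra.
Qed.

(** Sizes are at most [n], so the admissible vectors are finitely many functions into ['I_n.+1]. *)
Lemma exists_maximizer :
  exists2 w, blowup_vector G n w &
    forall v, blowup_vector G n v -> radius_power v <= radius_power w.
Proof.
have [e sum_e bal] := exists_spread.
have e_gt0 l : (0 < e l)%N by case: (bal l) => ->.
have bounded v : blowup_vector G n v -> forall i, (v i < n.+1)%N.
  by case=> _ <- i; rewrite ltnS (bigD1 i) //= leq_addr.
pose of_ffun (F : {ffun vertices G -> 'I_n.+1}) i : nat := F i.
pose valid F := [forall i, 0 < of_ffun F i]%N && (\sum_i of_ffun F i == n)%N.
have validP F : reflect (blowup_vector G n (of_ffun F)) (valid F).
  by apply: (iffP andP) => -[? ?]; split; try exact/forallP; exact/eqP.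
pose to_ffun (v : vertices G -> nat) : {ffun vertices G -> 'I_n.+1} := [ffun i => inord (v i)].
have to_ffunK v : blowup_vector G n v -> forall i, of_ffun (to_ffun v) i = v i.
  by move=> v_vec i; rewrite /of_ffun ffunE inordK // bounded.
have radius_ext v v' : (forall i, v i = v' i) -> radius_power v = radius_power v'.
  move=> vv'; have W o : class_weight v o = class_weight v' o by apply: eq_bigr => i _.
  by rewrite !radius_powerE W; congr (_ * _); apply: eq_bigr => l _; rewrite W.
have to_ffun_valid v : blowup_vector G n v -> valid (to_ffun v).
  move=> v_vec; apply/validP; split=> [i|]; first by rewrite to_ffunK //; case: v_vec.
  by rewrite (eq_bigr v) => [|i _]; [case: v_vec | rewrite to_ffunK].
have v0_vec := blowup_vector_spread e_gt0 sum_e.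
case: (Order.TotalTheory.arg_maxP (fun F => radius_power (of_ffun F))
         (to_ffun_valid _ v0_vec)).
move=> F /validP F_vec F_max; exists (of_ffun F) => // v v_vec.
rewrite -(radius_ext _ _ (to_ffunK v v_vec)).
exact/F_max/to_ffun_valid.
Qed.

Variable top : 'I_m.

Definition objective (s : nat) : R :=
  f (g k s) * ((m - 1)%:R + f (g q (n - s - (m - 1) * q))).

(** One-sided, since [i] and [j] can be exchanged. *)
Definition balanced (w : vertices G -> nat) o :=
  forall i j, pet i == o -> pet j == o -> (w i <= (w j).+1)%N.

Definition concentrated (w : vertices G -> nat) :=
  forall l, l != top -> forall i, pet i == Some l -> w i = 1%N.

Lemma radius_power_concentrated (w : vertices G -> nat) :
  concentrated w ->
  radius_power w = f (class_weight w None) * ((m - 1)%:R + f (class_weight w (Some top))).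
Proof.
move=> w1; rewrite radius_powerE (bigD1 top) //= addrC.
rewrite (eq_bigr (fun=> 1)); last by move=> l /w1 /class_weight1 ->; rewrite f1.
by rewrite sumr_const cardC1 card_ord subn1.
Qed.

Lemma concentrated_sums (w : vertices G -> nat) :
  blowup_vector G n w -> concentrated w ->
  let p := (\sum_(i | pet i == None) w i)%N in
  (k <= p <= n - m * q)%N /\ (\sum_(i | pet i == Some top) w i = n - p - (m - 1) * q)%N.
Proof.
move=> [w_gt0 sum_w] w1 p.
have sum_ge o : ((if o is Some _ then q else k) <= \sum_(i | pet i == o) w i)%N.
  by have := sum_class_const o 1; rewrite muln1 => <-; apply: leq_sum.
have := sum_classes w; rewrite sum_w -/p (bigD1 top) //=.
rewrite (eq_bigr (fun _ : 'I_m => q)) => [|l /w1 wl]; last first.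
  by rewrite (eq_bigr (fun=> 1%N)) // sum_class_const muln1.
rewrite sum_nat_const cardC1 card_ord => nE.
have := sum_ge None; have /= := sum_ge (Some top); rewrite -/p.
have : (m * q = q + (m - 1) * q)%N by case: m m_gt0 => // m' _; rewrite subn1 mulSn.
rewrite -subn1 in nE; move: (\sum_(i | _) w i)%N nE => y; lia.
Qed.

Lemma class_weight_le_g (w : vertices G -> nat) (o : option 'I_m) :
  (forall i, 0 < w i)%N ->
  let c := if o is Some _ then q else k in
  (class_weight w o <= g c (\sum_(i | pet i == o) w i))%N /\
  (class_weight w o = g c (\sum_(i | pet i == o) w i) <-> balanced w o).
Proof.
move=> w_gt0 c; rewrite /c -(card_pet o).
have c_gt0 : (0 < #|[pred i | pet i == o]|)%N by rewrite card_pet; case: (o).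
have [le_g eq_g] := @prod_leq_g R _ (fun i => pet i == o) w c_gt0 (fun i _ => w_gt0 i).
split=> //; rewrite /balanced (@balancedP _ (fun i => pet i == o) w c_gt0).
by rewrite -eq_g; split=> /eqP.
Qed.

(** Kernel and top petal are each bounded by [g]. Both factors are positive and strictly increasing
    in the weights, so equality forces equality in each bound, that is, balance. *)
Lemma radius_power_le_objective (w : vertices G -> nat) :
  blowup_vector G n w -> concentrated w ->
  let p := (\sum_(i | pet i == None) w i)%N in
  radius_power w <= objective p /\
  (radius_power w = objective p <-> balanced w None /\ balanced w (Some top)).
Proof.
move=> w_vec w1 p; have [w_gt0 _] := w_vec.
have [_ sum_top] := concentrated_sums w_vec w1; rewrite -/p in sum_top.
have [K_le K_eq] := class_weight_le_g None w_gt0.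
have [T_le T_eq] := class_weight_le_g (Some top) w_gt0.
rewrite /= -/p in K_le K_eq; rewrite /= sum_top in T_le T_eq.
rewrite (radius_power_concentrated w1) /objective.
set K := class_weight w None in K_le K_eq *; set T := class_weight w (Some top) in T_le T_eq *.
have K_gt0 : (0 < K)%N by apply: class_weight_gt0.
have T_gt0 : (0 < T)%N by apply: class_weight_gt0.
have m_ge0 : 0 <= (m - 1)%:R :> R by [].
split.
  have fK_ge0 := ltW (f_gt0 K_gt0); have fT_ge0 := ltW (f_gt0 T_gt0).
  by apply: ler_pM; rewrite ?lerD2l ?f_le ?addr_ge0.
split=> [eq_rp | [/K_eq -> /T_eq -> //]].
suff [KE TE] : K = g k p /\ T = g q (n - p - (m - 1) * q) by split; [apply/K_eq | apply/T_eq].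
split; apply/eqP; rewrite eqn_leq ?K_le ?T_le /= leqNgt; apply/negP => lt_g.
  suff : f K * ((m - 1)%:R + f T) < f (g k p) * ((m - 1)%:R + f (g q (n - p - (m - 1) * q))).
    by rewrite eq_rp ltxx.
  apply: (lt_le_trans (y := f (g k p) * ((m - 1)%:R + f T))).
    by rewrite ltr_pM2r ?f_lt // ltr_wpDl ?f_gt0.
  by rewrite ler_pM2l ?lerD2l ?f_le // f_gt0 // (leq_trans K_gt0).
suff : f K * ((m - 1)%:R + f T) < f (g k p) * ((m - 1)%:R + f (g q (n - p - (m - 1) * q))).
  by rewrite eq_rp ltxx.
apply: (lt_le_trans (y := f K * ((m - 1)%:R + f (g q (n - p - (m - 1) * q))))).
  by rewrite ltr_pM2l ?ltrD2l ?f_lt // f_gt0.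
by rewrite ler_wpM2r ?f_le // addr_ge0 // ltW // f_gt0 // (leq_trans T_gt0).
Qed.

Lemma exists_concentrated (s : nat) :
  (k <= s <= n - m * q)%N ->
  exists w, [/\ blowup_vector G n w, concentrated w,
    \sum_(i | pet i == None) w i = s & radius_power w = objective s]%N.
Proof.
move=> /andP[k_le s_le].
have mq : (m * q = q + (m - 1) * q)%N by case: m m_gt0 => // m' _; rewrite subn1 mulSn.
have balE o (x : nat) : ((if o is Some _ then q else k) <= x)%N ->
    exists v : vertices G -> nat, [/\ forall i, pet i == o -> (0 < v i)%N,
      balanced v o & \sum_(i | pet i == o) v i = x]%N.
  move=> x_ge; have c_gt0 : (0 < #|[pred i | pet i == o]|)%N by rewrite card_pet; case: (o).
  have [v bal sum_v] := @exists_balanced _ (fun i => pet i == o) x c_gt0.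
  exists v; split=> //.
    move=> i io; have := forall_inP bal i io.
    have : (0 < x %/ #|[pred i | pet i == o]|)%N by rewrite divn_gt0 // card_pet.
    by move=> x_gt0 /orP[] /eqP ->.
  by apply/(@balancedP _ (fun i => pet i == o) v c_gt0); rewrite sum_v.
have [u [u_gt0 u_bal sum_u]] := balE None s k_le.
have [|v [v_gt0 v_bal sum_v]] := balE (Some top) (n - s - (m - 1) * q)%N.
  by move: t_le_n; lia.
pose w i := if pet i == None then u i else if pet i == Some top then v i else 1%N.
have wu i : pet i == None -> w i = u i by rewrite /w => ->.
have wv i : pet i == Some top -> w i = v i by rewrite /w => /eqP ->; rewrite eqxx.
have w1 : concentrated w.
  by move=> l lt i /eqP il; rewrite /w il /= (inj_eq Some_inj) (negPf lt).
have sum_wu : (\sum_(i | pet i == None) w i = s)%N by rewrite -sum_u; apply: eq_bigr.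
have w_vec : blowup_vector G n w.
  split=> [i|].
    by rewrite /w; case: ifP => [/u_gt0 // | _]; case: ifP => [/v_gt0 |].
  rewrite sum_classes sum_wu (bigD1 top) //= (eq_bigr _ wv) sum_v.
  rewrite (eq_bigr (fun _ : 'I_m => q)) => [|l /w1 wl]; last first.
    by rewrite (eq_bigr (fun=> 1%N)) // sum_class_const muln1.
  by rewrite sum_nat_const cardC1 card_ord -subn1; move: t_le_n; lia.
exists w; split=> //; rewrite -sum_wu.
have [_ ->] := radius_power_le_objective w_vec w1.
by split=> i j ii jj; [rewrite !wu // u_bal | rewrite !wv // v_bal].
Qed.

(** By [merge_petals] at most one petal has weight above 1, and a swap makes it the petal [top].
    Since [objective p] is itself attained, maximality gives equality in
    [radius_power_le_objective], hence balance. *)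
Lemma maximizer_structure (w : vertices G -> nat) :
  blowup_vector G n w ->
  (forall v, blowup_vector G n v -> radius_power v <= radius_power w) ->
  exists l : 'I_m, let v := fun i => w (swap l top i) in
    let p := (\sum_(i | pet i == None) v i)%N in
    [/\ blowup_vector G n v, concentrated v, radius_power w = objective p,
        balanced v None & balanced v (Some top)].
Proof.
move=> w_vec w_max; have [w_gt0 sum_w] := w_vec.
have [l one_l] : exists l, forall l', l' != l -> class_weight w (Some l') = 1%N.
  have [l W_l | all1] := pickP (fun l => 1 < class_weight w (Some l))%N; last first.
    exists top => l' _; apply/eqP; rewrite eqn_leq class_weight_gt0 // andbT leqNgt.
    by rewrite all1.
  exists l => l' l'l; apply/eqP; rewrite eqn_leq class_weight_gt0 // andbT leqNgt.
  apply/negP => W_l'; have [v v_vec] := merge_petals w_vec l'l W_l' W_l.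
  by apply/negP; rewrite -leNgt w_max.
exists l => v p.
have v_vec : blowup_vector G n v.
  split=> [i|]; first exact: w_gt0.
  by rewrite -sum_w [RHS](reindex_inj (inv_inj (swapK l top))).
have v1 : concentrated v.
  move=> l' l't i il'; apply: (class_weight1P (w := w) (o := Some (tperm l top l'))).
    by apply: one_l; rewrite -(inj_eq (@perm_inj _ (tperm l top))) tpermK tpermL.
  by rewrite pet_swap (eqP il').
have rpE : radius_power w = radius_power v.
  apply: radius_power_isomorphic => [||]; [by [] | by case: v_vec |].
  exact: (sunflower_automorphism w (swapK l top) (pet_swap l top)).
have [p_range _] := concentrated_sums v_vec v1.
have [rp_le rp_eq] := radius_power_le_objective v_vec v1; rewrite -/p in rp_le rp_eq p_range.
have [v' [v'_vec _ _ rp_v']] := exists_concentrated p_range.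
have rp_p : radius_power v = objective p.
  by apply/eqP; rewrite eq_le rp_le -rp_v' -rpE w_max.
by have [bK bT] := (rp_eq.1 rp_p); rewrite rpE.
Qed.

(** * Sufficient conditions for extremality *)

Lemma spread_minimizer (w : vertices G -> nat) (e : 'I_m -> nat) :
  blowup_vector G n w -> (forall i, w i = spread e i) ->
  (forall l, e l = base \/ e l = base.+1) ->
  forall v, blowup_vector G n v -> radius_power w <= radius_power v.
Proof.
move=> w_vec w_e bal v v_vec.
have W o : class_weight w o = class_weight (spread e) o by apply: eq_bigr => i _.
have -> : radius_power w = radius_power (spread e).
  by rewrite !radius_powerE W; congr (_ * _); apply: eq_bigr => l _; rewrite W.
rewrite radius_power_spread //; first by have [] := radius_power_min v_vec.
rewrite /excess -(sum_excess w_vec) sum_classes.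
rewrite [X in (X + _ + _)%N]big1 => [|i i_K]; last first.
  by rewrite w_e spread_kernel.
rewrite add0n [LHS](eq_bigr (fun l => (e l).-1 + 1)%N) => [|l _]; last first.
  by rewrite addn1 prednK //; case: (bal l) => ->.
rewrite big_split /= sum1_card card_ord; congr (_ + _)%N; apply: eq_bigr => l _.
rewrite (bigD1 (last l)) ?pet_last //= w_e (spread_petal e (l := l)) ?pet_last // eqxx.
rewrite big1 ?addn0 // => i /andP[il /negPf i_last].
by rewrite w_e (spread_petal e il) i_last.
Qed.

(** Some maximizer exists, and by its structure its value is the objective at an admissible point,
    hence at most [objective p]. *)
Lemma concentrated_maximizer (w : vertices G -> nat) :
  blowup_vector G n w -> concentrated w -> balanced w None -> balanced w (Some top) ->
  let p := (\sum_(i | pet i == None) w i)%N in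
  (forall s, (k <= s <= n - m * q)%N -> objective s <= objective p) ->
  forall v, blowup_vector G n v -> radius_power v <= radius_power w.
Proof.
move=> w_vec w1 bK bT p p_max v v_vec.
have [_ /(_ (conj bK bT)) ->] := (radius_power_le_objective w_vec w1).2.
have [w0 w0_vec w0_max] := exists_maximizer.
have [l [v0_vec v0_1 rp_w0 _ _]] := maximizer_structure w0_vec w0_max.
apply: (le_trans (w0_max v v_vec)); rewrite rp_w0; apply: p_max.
by have [] := concentrated_sums v0_vec v0_1.
Qed.

End Sunflower.

(** * The sunflower on [t] vertices *)

Section ConcreteSunflower.

Variables (t m q r : nat).
Hypotheses (q_gt0 : (0 < q)%N) (m_gt0 : (0 < m)%N) (lt_qr : (q < r)%N).
Hypothesis t_def : (t = r + (m - 1) * q)%N.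

Let tE : (r - q + m * q = t)%N.
Proof. by case: m m_gt0 t_def => // m' _; rewrite subn1 mulSn; lia. Qed.

(** Past the kernel the petals are consecutive blocks of length [q]; there the quotient is below
    [m], so [insub] does not fail. *)
Definition petal_of (i : 'I_t) : option 'I_m :=
  if (i < r - q)%N then None else insub ((i - (r - q)) %/ q)%N.

Let petal_index_lt (i : 'I_t) : (r - q <= i)%N -> ((i - (r - q)) %/ q < m)%N.
Proof. by move=> le_i; rewrite ltn_divLR //; have := ltn_ord i; lia. Qed.

Lemma petal_of_kernel (i : 'I_t) : (petal_of i == None) = (i \in kernel t q r).
Proof.
rewrite inE /petal_of; case: ltnP => // le_i.
by rewrite insubT ?petal_index_lt.
Qed.

Lemma petal_of_petal (i : 'I_t) (l : 'I_m) :
  (petal_of i == Some l) = (i \in petal t q r l).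
Proof.
rewrite inE /petal_of; case: ltnP => [lt_i | le_i].
  by apply/esym/negbTE; rewrite negb_and -ltnNge (leq_trans lt_i) ?leq_addr.
rewrite insubT ?petal_index_lt // => lt_m; rewrite (inj_eq Some_inj) -val_eqE /=.
rewrite eqn_leq -ltnS ltn_divLR // leq_divRL //; move: (l * q)%N (mulSn l q) => x; lia.
Qed.

Lemma card_petal_of (o : option 'I_m) :
  #|[pred i | petal_of i == o]| = if o is Some _ then q else (r - q)%N.
Proof.
case: o => [l|].
  rewrite (eq_card (petal_of_petal^~ l)) card_ord_interval; first by lia.
  have : (l.+1 * q <= m * q)%N by rewrite leq_mul2r ltn_ord orbT.
  by rewrite mulSn -tE; lia.
rewrite (eq_card petal_of_kernel) -[RHS]subn0 -(@card_ord_interval t) -?tE ?leq_addr //.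
Qed.

Lemma edges_petal_of :
  edges (sunflower lt_qr t_def) =
  [set [set i | (petal_of i == None) || (petal_of i == Some l)] | l : 'I_m].
Proof.
rewrite /= /sunflower_edges; apply: eq_imset => l; apply/setP => i.
by rewrite in_setU [RHS]inE petal_of_kernel petal_of_petal.
Qed.

Let place_lt (l : 'I_m) (o : nat) : (o < q)%N -> (r - q + l * q + o < t)%N.
Proof.
move=> o_lt; have : (l.+1 * q <= m * q)%N by rewrite leq_mul2r ltn_ord orbT.
by rewrite mulSn -tE; lia.
Qed.

Definition place (l : 'I_m) (o : nat) (o_lt : (o < q)%N) : 'I_t :=
  Ordinal (place_lt l o_lt).

Lemma petal_of_place l o (o_lt : (o < q)%N) : petal_of (place l o_lt) = Some l.
Proof. by apply/eqP; rewrite petal_of_petal inE /=; lia. Qed.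

Let last_offset : (q.-1 < q)%N.
Proof. by rewrite prednK. Qed.

Definition last_vertex (l : 'I_m) : 'I_t := place l last_offset.

Lemma petal_of_last l : petal_of (last_vertex l) = Some l.
Proof. exact: petal_of_place. Qed.

Lemma eq_last_vertex (i : 'I_t) (l : 'I_m) :
  (i == last_vertex l) = (i.+1 == r + l * q)%N.
Proof. by rewrite -val_eqE /=; lia. Qed.

(** The offset inside the block is kept, which makes the swap an involution. *)
Definition petal_swap (l1 l2 : 'I_m) (i : 'I_t) : 'I_t :=
  if petal_of i is Some l then
    place (tperm l1 l2 l) (ltn_pmod (i - (r - q)) q_gt0)
  else i.

Lemma petal_of_swap l1 l2 i :
  petal_of (petal_swap l1 l2 i) = omap (tperm l1 l2) (petal_of i).
Proof.
rewrite {1}/petal_swap; case il: (petal_of i) => [l|] //=.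
exact: petal_of_place.
Qed.

Lemma petal_swapK l1 l2 : involutive (petal_swap l1 l2).
Proof.
move=> i; apply: val_inj; rewrite /petal_swap.
case il: (petal_of i) => [l|]; last by rewrite il.
rewrite petal_of_place /= tpermK -[X in ((X - _) %% _)%N]addnA addKn modnMDl modn_mod.
move/eqP: il; rewrite /petal_of; case: ltnP => // le_i.
rewrite insubT ?petal_index_lt // => lt_m /eqP[<-] /=.
by rewrite -addnA -divn_eq subnKC.
Qed.

End ConcreteSunflower.

Lemma ceil_divE (a m : nat) :
  (0 < m)%N -> ceil_div a m = (a %/ m + (a %% m != 0))%N.
Proof.
move=> m_gt0; rewrite /ceil_div {1}(divn_eq a m) -addnA divnMDl //; congr (_ + _)%N.
have := ltn_pmod a m_gt0; case: eqP => [-> _ | /eqP a_neq0 a_lt].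
  by rewrite add0n divn_small // subn1 prednK.
rewrite (_ : (a %% m + (m - 1) = 1 * m + (a %% m).-1)%N); last by lia.
by rewrite divnMDl // divn_small //; lia.
Qed.

Local Open Scope nat_scope.

Theorem theorem4p5 (R : realType) (q m r t n : nat)
    (hq : 2 <= q) (lt_qr : q < r) (hm : 2 <= m) (hr : 3 <= r)
    (t_def : t = r + (m - 1) * q) (hn : t <= n) :
  let SH := sunflower lt_qr t_def in
  (forall w : 'I_t -> nat, blowup_vector SH n w ->
     (attains_min_spectral_radius R (blowups SH n) (blowup SH w) <->
      exists w' : 'I_t -> nat,
        [/\ blowup_vector SH n w',
            minimizing_vector m q r n w' &
            isomorphic (blowup SH w) (blowup SH w')])) /\
  (forall w : 'I_t -> nat, blowup_vector SH n w ->
     (attains_max_spectral_radius R (blowups SH n) (blowup SH w) <->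
      exists p, is_maximum_point R m q r n p /\
        exists w' : 'I_t -> nat,
          [/\ blowup_vector SH n w',
              maximizing_vector m q r n p w' &
              isomorphic (blowup SH w) (blowup SH w')])).
Proof.
move=> SH.
have q_gt0 : 0 < q by lia.
have m_gt0 : 0 < m by lia.
have k_gt0 : 0 < r - q by rewrite subn_gt0.
have r_def : r = (r - q) + q by lia.
have card_pet := card_petal_of q_gt0 m_gt0 lt_qr t_def.
have edges_pet := edges_petal_of q_gt0 m_gt0 lt_qr t_def.
have tE : r - q + m * q = t.
  have -> : m * q = q + (m - 1) * q by rewrite -mulSn subn1 prednK.
  by rewrite t_def; lia.
have t_le_n : r - q + m * q <= n by rewrite tE.
have pet_last := petal_of_last q_gt0 m_gt0 lt_qr t_def.
have swapK := petal_swapK q_gt0 m_gt0 lt_qr t_def.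
have pet_swap := petal_of_swap q_gt0 m_gt0 lt_qr t_def.
have pet_kernel := petal_of_kernel q_gt0 m_gt0 lt_qr t_def.
have pet_petal := petal_of_petal q_gt0 m_gt0 lt_qr t_def.
have eq_last := eq_last_vertex q_gt0 m_gt0 lt_qr t_def.
set pet := @petal_of t m q r in card_pet edges_pet pet_last swapK pet_swap
  pet_kernel pet_petal.
set last := last_vertex _ _ _ _ in pet_last eq_last.
set swap := petal_swap _ _ _ _ in swapK pet_swap.
have gt0 v : blowup_vector SH n v -> forall j, 0 < v j by case.
have vecP (s : 'I_t -> 'I_t) w : involutive s ->
    blowup_vector SH n w -> blowup_vector SH n (fun i => w (s i)).
  move=> sK [w_gt0 <-]; split=> [i0|]; first exact: w_gt0.
  by rewrite [RHS](reindex_inj (inv_inj sK)).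
have lastP (i : 'I_t) : reflect (exists l, i = last l) [exists l : 'I_m, i.+1 == r + l * q].
  apply: (iffP existsP) => -[l]; first by rewrite -eq_last => /eqP; exists l.
  by move/eqP; rewrite eq_last; exists l.
have spreadE e (i : 'I_t) : @spread m r SH pet last e i =
    if [exists l : 'I_m, i.+1 == r + l * q] then odflt 0 (omap e (pet i)) else 1.
  rewrite /spread; case: lastP => [[l ->] | not_last]; first by rewrite pet_last eqxx.
  by case: (pet i) => // l; case: eqP => // il; case: not_last; exists l.
split=> w w_vec.
  rewrite (attains_minE R (G := SH) k_gt0 q_gt0 m_gt0 r_def card_pet edges_pet w_vec); split.
    move=> w_min; have := minimizer_structure (G := SH) k_gt0 q_gt0 m_gt0
      r_def card_pet hq hm t_le_n pet_last w_vec w_min.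
    case=> e [s [sum_e bal sK pet_s w_s]].
    exists (fun i => w (s i)); split; first exact: vecP.
      move=> i; rewrite w_s spreadE; case: lastP => // -[l ->]; rewrite pet_last /=.
      rewrite ceil_divE // -tE addn1; case: (bal l) => el; first by left.
      right; rewrite el; suff -> : ((n - (r - q + m * q)) %% m != 0) by rewrite !addn1.
      (* A petal of weight [base.+1] pushes the total above [m * base]; hence [m] does not divide
         [n - t], and the ceiling is the floor plus one. *)
      have : \sum_(l : 'I_m) e l > m * ((n - (r - q + m * q)) %/ m).+1.
        rewrite (bigD1 l) //= el -{1}(card_ord m) -sum_nat_const (bigD1 l) //=.
        by rewrite -addSn leq_add2l; apply: leq_sum => l' _; case: (bal l') => ->.
      rewrite sum_e {2}(divn_eq (n - (r - q + m * q)) m) mulnS mulnC; lia.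
    have pet_s' i : pet (s i) = omap id (pet i) by rewrite pet_s; case: (pet i).
    exact: (sunflower_automorphism (G := SH) k_gt0 q_gt0 card_pet edges_pet w sK pet_s').
  case=> w' [w'_vec w'_min iso_w] v v_vec.
  rewrite (radius_power_isomorphic R (G := SH) k_gt0 q_gt0 m_gt0 r_def card_pet
    edges_pet (gt0 _ w_vec) (gt0 _ w'_vec) iso_w).
  apply: (spread_minimizer R (G := SH) k_gt0 q_gt0 m_gt0 r_def card_pet hq hm t_le_n pet_last
    (e := fun l => w' (last l)) w'_vec) => // [i0 | l].
    rewrite spreadE; have := w'_min i0; case: lastP => // -[l ->] _.
    by rewrite pet_last.
  have := w'_min (last l); case: lastP => [_ | []]; last by exists l.
  (* When [m] divides [n - t], floor and ceiling coincide and both alternatives give [base]. *)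
  rewrite ceil_divE // tE !addn1; case: eqP => _; rewrite ?addn0 ?addn1.
    by case; left.
  by case; [left | right].
have lt_top : m - 1 < m by lia.
(* Petals are numbered from 0, so the petal [Y_m] has index [m - 1]. *)
pose top := Ordinal lt_top.
rewrite (attains_maxE R (G := SH) k_gt0 q_gt0 m_gt0 r_def card_pet edges_pet w_vec); split.
  move=> w_max.
  have [l /= [v_vec v1 rpE bK bT]] := maximizer_structure (G := SH) k_gt0 q_gt0 m_gt0 r_def
    card_pet edges_pet hq hm t_le_n swapK pet_swap top w_vec w_max.
  set v := fun i => w (swap l top i) in v_vec v1 rpE bK bT.
  set p := \sum_(i | pet i == None) v i in rpE.
  have [p_range sum_top] := concentrated_sums R (G := SH) k_gt0 q_gt0 m_gt0
    r_def card_pet hq hm t_le_n v_vec v1.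
  exists p; split.
    split=> // s s_range.
    have [u [u_vec _ _ rp_u]] := exists_concentrated R (G := SH) k_gt0
      q_gt0 m_gt0 r_def card_pet hq hm t_le_n top s_range.
    by have := w_max u u_vec; rewrite rp_u rpE.
  exists v; split=> //; last first.
    exact: (sunflower_automorphism (G := SH) k_gt0 q_gt0 card_pet edges_pet w
      (swapK l top) (pet_swap l top)).
  split.
  - by apply: eq_bigl => i; rewrite -pet_kernel.
  - rewrite subnAC -sum_top; apply: eq_bigl => i.
    by rewrite (pet_petal i top).
  - move=> i j; rewrite -!pet_kernel -!(pet_petal _ top).
    case/orP => /andP[ii jj].
      by have := bK i j ii jj; have := bK j i jj ii; lia.
    by have := bT i j ii jj; have := bT j i jj ii; lia.
  - move=> l' l'_lt j; have lt_l' : l' < m by lia.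
    rewrite -(pet_petal j (Ordinal lt_l')); apply: v1.
    by rewrite -val_eqE /= ltn_eqF.
case=> p [[p_range p_max] [w' [w'_vec [sum_K _ bal one] iso_w]]] v v_vec.
rewrite (radius_power_isomorphic R (G := SH) k_gt0 q_gt0 m_gt0 r_def card_pet
    edges_pet (gt0 _ w_vec) (gt0 _ w'_vec) iso_w).
have w'1 : concentrated (G := SH) pet top w'.
  move=> l l_top i il; apply: (one l); last by rewrite -pet_petal.
  have : l != m - 1 :> nat by rewrite -val_eqE in l_top.
  by have := ltn_ord l; lia.
have sumE : \sum_(i | pet i == None) w' i = p.
  by rewrite -sum_K; apply: eq_bigl => i; rewrite pet_kernel.
apply: (concentrated_maximizer (G := SH) k_gt0 q_gt0 m_gt0 r_def card_pet
  edges_pet hq hm t_le_n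
  pet_last swapK pet_swap w'_vec w'1) => //.
- move=> i j; rewrite !pet_kernel => ii jj.
  by have := bal i j; rewrite ii jj => /(_ isT); lia.
- move=> i j; rewrite !pet_petal => ii jj.
  by have := bal i j; rewrite ii jj orbT => /(_ isT); lia.
by rewrite sumE.
Qed.
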